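(* Let $\mathcal L^{(0)},\mathcal L^{(1)},\mathcal L^{(2)}$ be Lindbladians on $M_d(\mathbb C)$ and let $(\mathcal L_\gamma)_{\gamma>0}$ be the family of Lindbladians $\mathcal L_\gamma=\mathcal L^{(0)}+\gamma\mathcal L^{(1)}+\gamma^2\mathcal L^{(2)}$. Assume that $\mathcal L^{(2)}$ has no nonzero purely imaginary eigenvalues, and that $\mathcal P\mathcal L^{(1)}\mathcal P=0$, where $\mathcal P:=\lim_{t\to\infty}e^{t\mathcal L^{(2)}}$ (this limit exists and is a projector). Then for any $t>0$, $$\lim_{\gamma\to\infty}e^{t\mathcal L_\gamma}=\mathcal P\,e^{t\mathcal L_\infty}\,\mathcal P,\qquad \mathcal L_\infty=\mathcal P\mathcal L^{(0)}\mathcal P-\mathcal P\mathcal L^{(1)}\big(\mathcal L^{(2)}\big)^{-1}\mathcal L^{(1)}\mathcal P ,$$ where $(\mathcal L^{(2)})^{-1}$ is the pseudo-inverse of $\mathcal L^{(2)}$.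
   Context: A Lindbladian on $M_d(\mathbb C)$ is the generator of a continuous semigroup of completely positive trace-preserving linear maps of $M_d(\mathbb C)$; equivalently, an operator of the form $\mathcal L(X)=-\mathrm i[H,X]+\sum_{k=1}^\ell\big(L_kXL_k^*-\tfrac12\{L_k^*L_k,X\}\big)$ with $H=H^*$ and $L_k$ in $M_d(\mathbb C)$, where $[X,Y]=XY-YX$ and $\{X,Y\}=XY+YX$. Products of operators on $M_d(\mathbb C)$ are compositions. The pseudo-inverse is $(\mathcal L^{(2)})^{-1}:=-\int_0^\infty\big(e^{s\mathcal L^{(2)}}-\mathcal P\big)\,ds$; it is zero on $\operatorname{Ker}\mathcal L^{(2)}=\operatorname{Im}\mathcal P$ and equals the inverse of the restriction of $\mathcal L^{(2)}$ on $\operatorname{Ker}\mathcal P$. *)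

(* Defs.v *)
From HB Require Import structures.
From mathcomp Require Import all_boot all_order all_algebra.
From mathcomp Require Import complex.
From mathcomp Require Import all_classical all_reals all_analysis.
Import numFieldNormedType.Exports.
Import Order.TTheory GRing.Theory Num.Theory.
Set Implicit Arguments.
Unset Strict Implicit.
Unset Printing Implicit Defensive.
Local Open Scope classical_set_scope.
Local Open Scope complex_scope.
Local Open Scope sesquilinear_scope.
Local Open Scope ring_scope.

(* [numFieldNormedType.Exports] only reaches abstract field types, so the
   topology given by the modulus is declared on the concrete type [R[i]]. *)
#[non_forgetful_inheritance]
HB.instance Definition _ (R : realType) :=
  PseudoPointedMetric.copy R[i] R[i]^o.
#[non_forgetful_inheritance]
HB.instance Definition _ (R : realType) :=
  NormedModule.copy R[i] R[i]^o.

(* The order of [R[i]] is the partial one: [0 <= z] says that [z] is real and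
   nonnegative, so a matrix satisfying [psdmx] is automatically Hermitian. *)
Definition psdmx (R : realType) (n : nat) (A : 'M[R[i]]_n) : Prop :=
  forall v : 'cV[R[i]]_n, 0 <= (v^t* *m A *m v) 0 0.

(* An element of M_n (x) M_d is an n x n block matrix with blocks in M_d, on
   which id (x) Phi acts blockwise. *)
Definition completely_positive (R : realType) (d : nat)
    (Phi : 'M[R[i]]_d -> 'M[R[i]]_d) : Prop :=
  forall (n : nat) (X : 'I_n -> 'I_n -> 'M[R[i]]_d),
    psdmx (@mxblock _ n n (fun=> d) (fun=> d) X) ->
    psdmx (@mxblock _ n n (fun=> d) (fun=> d) (fun i j => Phi (X i j))).

Definition trace_preserving (R : realType) (d : nat)
    (Phi : 'M[R[i]]_d -> 'M[R[i]]_d) : Prop :=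
  forall X, \tr (Phi X) = \tr X.

(* [M_d] is finite-dimensional, so convergence of operators is the same in
   operator norm and pointwise; the pointwise form is used throughout. Only the
   values of [T] at nonnegative times matter. *)
Record cptp_semigroup (R : realType) (d : nat)
    (T : R -> {linear 'M[R[i]]_d -> 'M[R[i]]_d}) : Prop := CptpSemigroup {
  cptp_semigroup0 : forall X, T 0 X = X;
  cptp_semigroupD : forall s t : R, 0 <= s -> 0 <= t ->
    forall X, T (s + t) X = T s (T t X);
  cptp_semigroup_continuous : forall X,
    {within `[0, +oo[, continuous (fun t : R => T t X : 'M[R[i]]_d)};
  cptp_semigroup_cp : forall t : R, 0 <= t -> completely_positive (T t);
  cptp_semigroup_tp : forall t : R, 0 <= t -> trace_preserving (T t)
}.

Definition lindbladian (R : realType) (d : nat)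
    (L : 'M[R[i]]_d -> 'M[R[i]]_d) : Prop :=
  exists2 T : R -> {linear 'M[R[i]]_d -> 'M[R[i]]_d}, cptp_semigroup T &
    forall X, (h%:C)^-1 *: (T h X - X) @[h --> 0^'+] --> L X.

Definition opexp (R : realType) (d : nat) (A : 'M[R[i]]_d -> 'M[R[i]]_d)
    (X : 'M[R[i]]_d) : 'M[R[i]]_d :=
  lim (series (fun n : nat => (n`!%:R)^-1 *: iter n A X) @ \oo).

Definition opexpt (R : realType) (d : nat) (t : R)
    (L : 'M[R[i]]_d -> 'M[R[i]]_d) : 'M[R[i]]_d -> 'M[R[i]]_d :=
  opexp (fun X => t%:C *: L X).

Definition asymptotic_proj (R : realType) (d : nat)
    (L : 'M[R[i]]_d -> 'M[R[i]]_d) (X : 'M[R[i]]_d) : 'M[R[i]]_d :=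
  lim (opexpt t L X @[t --> +oo]).

Definition mx_integral (R : realType) (m n : nat) (D : set R)
    (F : R -> 'M[R[i]]_(m, n)) : 'M[R[i]]_(m, n) :=
  \matrix_(i, j) ((\int[lebesgue_measure]_(s in D) complex.Re (F s i j))
               +i* (\int[lebesgue_measure]_(s in D) complex.Im (F s i j))).

Definition pseudo_inverse (R : realType) (d : nat)
    (L : 'M[R[i]]_d -> 'M[R[i]]_d) (X : 'M[R[i]]_d) : 'M[R[i]]_d :=
  - mx_integral `[0, +oo[ (fun s => opexpt s L X - asymptotic_proj L X).

Definition quadratic_family (R : realType) (d : nat)
    (L0 L1 L2 : 'M[R[i]]_d -> 'M[R[i]]_d) (gamma : R) (X : 'M[R[i]]_d) :
    'M[R[i]]_d :=
  L0 X + gamma%:C *: L1 X + (gamma ^+ 2)%:C *: L2 X.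

(* Main.v *)
Require Import Defs.
From HB Require Import structures.
From mathcomp Require Import all_boot all_order all_algebra.
From mathcomp Require Import complex.
From mathcomp Require Import all_classical all_reals all_analysis.
From mathcomp Require Import measurable_realfun.
From mathcomp Require Import ring lra.
Import numFieldNormedType.Exports.
Import Order.TTheory GRing.Theory Num.Theory.
Local Open Scope classical_set_scope.
Local Open Scope complex_scope.
Local Open Scope ring_scope.

(** Write P for the asymptotic projector of L2, S for its pseudo-inverse,
Q = L0 - L1 S L1, G = P Q P and A = L0 + g L1 + g^2 L2.

Everything rests on a bound on e^(tA) that is uniform in t >= 0 and g > 0.
Positive trace-preserving maps form a bounded set that is stable under
composition, so the supremum of the norm of Phi X over all such maps Phi is a
norm in which each of them is a contraction.  A generator of such a semigroup
is therefore dissipative for that norm: X + h L X has norm at most 1 + o(h)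
times that of X.  This property, unlike the semigroup itself, visibly passes to
sums and positive multiples ([dissipativeD], [dissipativeZ]), and it implies
that the exponential is a contraction ([opexpt_gauge]).

For L2 alone, boundedness forces every eigenvalue to have nonpositive real part
and 0 to be a semisimple eigenvalue; as 0 is by assumption the only eigenvalue
on the imaginary axis, every orbit is the sum of a fixed vector and of an
exponentially decaying orbit ([spectral_splitting]).  So P exists, L2 vanishes
on its range, X - P X lies in the range of L2, and the integral that defines S
can be evaluated by the fundamental theorem of calculus; this gives
L2 S = 1 - P ([gen_pseudo_inverse]).

On the range of P the limit is obtained from an approximate intertwining of A
with G.  For M = P - S L1 P / g - S Q P / g^2 the positive powers of g and the
constant term cancel in M G - A M, by L2 S = 1 - P and P L1 P = 0, and what
remains is O(1/g) ([corrector_residual]).  A discrete form of the Duhamel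
formula turns this into a bound on M e^(tG) - e^(tA) M
([opexpt_intertwining_error]), and M - P is itself O(1/g)
([slow_modes_limit]).

On the kernel of P one looks at the short time tau / g^2: the rescaled
generator A / g^2 tends to L2, hence e^((tau/g^2) A) X is close to
e^(tau L2) X, which is small for tau large; the uniform bound propagates the
smallness to time t ([fast_modes_vanish]). *)

Set Implicit Arguments.
Unset Strict Implicit.
Unset Printing Implicit Defensive.

(** * A real-valued norm on complex matrices *)

(** Limits and integrals of operators come as plain functions; this gives them the
structure of linear maps once linearity is known. *)
Lemma linear_lift (R : realType) (d : nat) (f : 'M[R[i]]_d -> 'M[R[i]]_d) :
  linear f -> exists g : {linear 'M[R[i]]_d -> 'M[R[i]]_d}, g =1 f.
Proof.
move=> lf; pose m := GRing.isLinear.Build _ _ _ _ f lf.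
pose g : {linear 'M[R[i]]_d -> 'M[R[i]]_d} := HB.pack f m.
by exists g.
Qed.

Lemma complex_ReD (R : realType) (x y : R[i]) : complex.Re (x + y) = complex.Re x + complex.Re y.
Proof. by case: x y => [a b] [c e]. Qed.

Lemma complex_ImD (R : realType) (x y : R[i]) : complex.Im (x + y) = complex.Im x + complex.Im y.
Proof. by case: x y => [a b] [c e]. Qed.

Lemma complex_ReM (R : realType) (x y : R[i]) :
  complex.Re (x * y) = complex.Re x * complex.Re y - complex.Im x * complex.Im y.
Proof. by case: x y => [a b] [c e]. Qed.

Lemma complex_ImM (R : realType) (x y : R[i]) :
  complex.Im (x * y) = complex.Re x * complex.Im y + complex.Im x * complex.Re y.
Proof. by case: x y => [a b] [c e]. Qed.

(** Like the modulus it is submultiplicative, but it is real-valued and keeps square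
roots out of the estimates. *)
Definition cabs1 (R : realType) (z : R[i]) : R :=
  `|complex.Re z| + `|complex.Im z|.

(** The real and imaginary parts of the entries: the real coordinates of a matrix,
in which all the calculus is done. *)
Definition rcoord (R : realType) (d : nat) (k : bool * ('I_d * 'I_d))
    (X : 'M[R[i]]_d) : R :=
  if k.1 then complex.Re (X k.2.1 k.2.2) else complex.Im (X k.2.1 k.2.2).

Definition norm1 (R : realType) (d : nat) (X : 'M[R[i]]_d) : R :=
  \sum_k `|rcoord k X|.

Section coordinates.
Context {R : realType} {d : nat}.
Local Notation V := 'M[R[i]]_d.
Implicit Types (X Y : V) (k : bool * ('I_d * 'I_d)).

Lemma rcoordD k X Y : rcoord k (X + Y) = rcoord k X + rcoord k Y.
Proof. by rewrite /rcoord mxE; case: k.1; rewrite ?complex_ReD ?complex_ImD. Qed.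

Lemma rcoord0 k : rcoord k (0 : V) = 0.
Proof. by rewrite /rcoord mxE; case: k.1. Qed.

Lemma rcoordN k X : rcoord k (- X) = - rcoord k X.
Proof. by apply/eqP; rewrite -addr_eq0 -rcoordD addNr rcoord0. Qed.

Lemma rcoordB k X Y : rcoord k (X - Y) = rcoord k X - rcoord k Y.
Proof. by rewrite rcoordD rcoordN. Qed.

Lemma rcoord_sum k I (r : seq I) (Q : pred I) (F : I -> V) :
  rcoord k (\sum_(i <- r | Q i) F i) = \sum_(i <- r | Q i) rcoord k (F i).
Proof. by apply: (big_morph (rcoord k)); [exact: rcoordD | exact: rcoord0]. Qed.

Lemma rcoordZ k (r : R) X : rcoord k (r%:C *: X) = r * rcoord k X.
Proof. by rewrite /rcoord mxE; case: k.1; rewrite ?complex_ReM ?complex_ImM /= ?mul0r ?subr0 ?addr0. Qed.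

Lemma rcoord_inj X Y : (forall k, rcoord k X = rcoord k Y) -> X = Y.
Proof.
move=> h; apply/matrixP => i j.
have := h (true, (i, j)); have := h (false, (i, j)); rewrite /rcoord /=.
by case: (X i j) (Y i j) => [a b] [c e] /= -> ->.
Qed.

Lemma rcoord_le_norm1 k X : `|rcoord k X| <= norm1 X.
Proof. by rewrite /norm1 (bigD1 k) //= lerDl sumr_ge0. Qed.

Lemma norm1_ge0 X : 0 <= norm1 X.
Proof. exact: sumr_ge0. Qed.

Lemma norm1_0 : norm1 (0 : V) = 0.
Proof. by rewrite /norm1 big1 // => k _; rewrite rcoord0 normr0. Qed.

Lemma norm1_eq0 X : norm1 X = 0 -> X = 0.
Proof.
move=> h; apply: rcoord_inj => k; rewrite rcoord0; apply/eqP.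
by rewrite -normr_le0 -h rcoord_le_norm1.
Qed.

Lemma norm1D X Y : norm1 (X + Y) <= norm1 X + norm1 Y.
Proof.
by rewrite /norm1 -big_split /=; apply: ler_sum => k _; rewrite rcoordD ler_normD.
Qed.

Lemma norm1N X : norm1 (- X) = norm1 X.
Proof. by apply: eq_bigr => k _; rewrite rcoordN normrN. Qed.

Lemma norm1B X Y : norm1 (X - Y) <= norm1 X + norm1 Y.
Proof. by rewrite -[norm1 Y]norm1N norm1D. Qed.

Lemma norm1Zr (r : R) X : norm1 (r%:C *: X) = `|r| * norm1 X.
Proof. by rewrite /norm1 mulr_sumr; apply: eq_bigr => k _; rewrite rcoordZ normrM. Qed.

Lemma norm1_sum I (r : seq I) (Q : pred I) (F : I -> V) :
  norm1 (\sum_(i <- r | Q i) F i) <= \sum_(i <- r | Q i) norm1 (F i).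
Proof.
apply: (big_ind2 (fun x y => norm1 x <= y)) => [|X1 x1 X2 x2 h1 h2|//].
  by rewrite norm1_0.
by apply: (le_trans (norm1D _ _)); exact: lerD.
Qed.

Lemma norm1E X : norm1 X = \sum_i \sum_j cabs1 (X i j).
Proof.
rewrite pair_bigA /=.
transitivity (\sum_(b : bool) \sum_(p : 'I_d * 'I_d) `|rcoord (b, p) X|).
  by rewrite pair_bigA; apply: eq_bigr => -[b p].
by rewrite big_bool -big_split.
Qed.

Lemma cabs1_le_norm1 X i j : cabs1 (X i j) <= norm1 X.
Proof.
have h0 z : 0 <= cabs1 (R := R) z by rewrite addr_ge0.
rewrite norm1E (bigD1 i) //= (bigD1 j) //= -addrA lerDl addr_ge0 ?sumr_ge0 //.
by move=> k _; rewrite sumr_ge0.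
Qed.

Lemma norm1Z (z : R[i]) X : norm1 (z *: X) <= cabs1 z * norm1 X.
Proof.
rewrite !norm1E mulr_sumr ler_sum // => i _; rewrite mulr_sumr ler_sum // => j _.
rewrite mxE; case: z (X i j) => [a b] [c e]; rewrite /cabs1 /=.
rewrite mulrDl !mulrDr -!normrM.
have := ler_normB (a * c) (b * e); have := ler_normD (a * e) (b * c).
lra.
Qed.

(** A linear map is controlled by its values on the matrix units; the sum makes the
bound uniform in [X] as soon as those finitely many values are small. *)
Lemma norm1_linear_le (A : {linear V -> V}) X :
  norm1 (A X) <= (\sum_i \sum_j norm1 (A (delta_mx i j))) * norm1 X.
Proof.
rewrite {1}(matrix_sum_delta X) linear_sum /=.
apply: (le_trans (norm1_sum _ _ _)).
rewrite mulr_suml ler_sum // => i _; rewrite linear_sum mulr_suml /=.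
apply: (le_trans (norm1_sum _ _ _)); rewrite ler_sum // => j _.
rewrite linearZ /= (le_trans (norm1Z _ _)) // mulrC ler_wpM2l ?norm1_ge0 //.
exact: cabs1_le_norm1.
Qed.

Lemma norm1_linear_bound (A : {linear V -> V}) :
  exists2 K : R, 0 < K & forall X, norm1 (A X) <= K * norm1 X.
Proof.
exists (1 + \sum_i \sum_j norm1 (A (delta_mx i j))).
  by rewrite ltr_pwDl // sumr_ge0 // => i _; rewrite sumr_ge0 // => j _; exact: norm1_ge0.
by move=> X; rewrite (le_trans (norm1_linear_le A X)) // ler_wpM2r ?norm1_ge0 // lerDr.
Qed.

Lemma cvg_rcoordP {T : Type} {F : set_system T} {FF : Filter F} (f : T -> V) (l : V) :
  f x @[x --> F] --> l <-> forall k, rcoord k (f x) @[x --> F] --> rcoord k l.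
Proof.
split=> [/cvg_ballP h k|h].
  apply/cvgrPdist_lt => e e0.
  have := h e%:C; rewrite ltcR => /(_ e0); apply: filterS => x [_] /(_ k.2.1 k.2.2).
  rewrite /ball /= -rcoordB normc_def -complexr0 ltcE /= => /andP[_]; apply: le_lt_trans.
  rewrite /rcoord !mxE; case: (l k.2.1 k.2.2) (f x k.2.1 k.2.2) => [a b] [a' b'] /=.
  by case: k.1 => /=; rewrite -[leLHS]sqrtr_sqr ler_sqrt ?lerDl ?lerDr ?addr_ge0 ?sqr_ge0.
apply/cvg_ballP => e; rewrite ltcE /= => /andP[/eqP e0 e1].
have [n n0] : exists n : R, 0 < n /\ n + n <= complex.Re e.
  by exists (complex.Re e / 2); split; lra.
have : \forall x \near F, forall k, `|rcoord k l - rcoord k (f x)| < n.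
  apply: filter_forall => k; have /cvgrPdist_lt := h k; apply; exact: n0.1.
apply: filterS => x hx; split; first by rewrite ltcE /= e0 eqxx.
move=> i j; rewrite /ball /= normc_def -complexr0 ltcE /= e0 eqxx /=.
have := hx (true, (i, j)); have := hx (false, (i, j)); rewrite /rcoord /=.
case: (l i j) (f x i j) => [a b] [a' b'] /= hb ha.
rewrite (lt_le_trans _ n0.2) //.
rewrite -[ltRHS]ger0_norm; last by lra.
rewrite -sqrtr_sqr ltr_sqrt; last by rewrite exprn_gt0; lra.
rewrite -[X in X + _ < _]real_normK ?num_real // -[X in _ + X < _]real_normK ?num_real //.
have := normr_ge0 (a - a'); have := normr_ge0 (b - b'); nra.
Qed.

Lemma cvg_rcoord {T : Type} {F : set_system T} {FF : Filter F} (f : T -> V) (l : V) k :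
  f x @[x --> F] --> l -> rcoord k (f x) @[x --> F] --> rcoord k l.
Proof. by move/cvg_rcoordP. Qed.

Lemma cvg_norm1P {T : Type} {F : set_system T} {FF : Filter F} (f : T -> V) (l : V) :
  f x @[x --> F] --> l <-> norm1 (f x - l) @[x --> F] --> 0.
Proof.
rewrite cvg_rcoordP; split=> [h|h k].
  rewrite -[X in _ --> X](_ : \sum_(k : bool * ('I_d * 'I_d)) (0 : R) = 0); last by rewrite big1.
  apply: cvg_big => [|k _]; first exact: add_continuous.
  apply/cvgr0Pnorm_lt => e e0.
  have /cvgrPdist_lt/(_ _ e0) := h k; apply: filterS => x.
  by rewrite normr_id rcoordB distrC.
apply/cvgrPdist_lt => e e0.
have /cvgr0Pnorm_lt/(_ _ e0) := h; apply: filterS => x.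
rewrite ger0_norm ?norm1_ge0 // => hx; rewrite -rcoordB (le_lt_trans _ hx) //.
by rewrite -norm1N opprB rcoord_le_norm1.
Qed.

Lemma cvg_norm1_lim {T : Type} {F : set_system T} {FF : ProperFilter F} (f : T -> V) (l : V) :
  f x @[x --> F] --> l -> lim (f x @[x --> F]) = l.
Proof.
move=> fl; have fL : f x @[x --> F] --> lim (f x @[x --> F]) by apply: cvgP fl.
move/cvg_rcoordP in fl; move/cvg_rcoordP in fL; apply: rcoord_inj => k.
by rewrite -(cvg_lim (@Rhausdorff R) (fL k)) (cvg_lim (@Rhausdorff R) (fl k)).
Qed.

End coordinates.

(** * The operator exponential *)

Lemma is_derive_bigsum (R : realType) (I : Type) (r : seq I) (F : I -> R -> R)
    (F' : I -> R) (t : R) :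
  (forall i, is_derive t 1 (F i) (F' i)) ->
  is_derive t 1 (fun s => \sum_(i <- r) F i s) (\sum_(i <- r) F' i).
Proof.
move=> h; elim: r => [|i r IH].
  rewrite big_nil (_ : (fun _ => _) = cst 0); first exact: is_derive_cst.
  by apply/funext => s; rewrite big_nil.
rewrite big_cons (_ : (fun _ => _) = F i + (fun s => \sum_(i <- r) F i s)).
  exact: is_deriveD.
by apply/funext => s; rewrite big_cons.
Qed.

Lemma is_derive_expRM (R : realType) (a t : R) :
  is_derive t 1 (fun s => expR (a * s)) (a * expR (a * t)).
Proof.
have -> : (fun s => expR (a * s)) = expR \o (a *: (id : R -> R)) by [].
apply: is_derive_eq.
by rewrite [RHS]mulrC; congr (_ * _); exact: mulr1.
Qed.

(** The function [g t * expR (- a * t) - c / (b - a) * expR ((b - a) * t)] has a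
nonpositive derivative. *)
Lemma gronwall (R : realType) (g g' : R -> R) (a b c : R) : a < b -> 0 <= c ->
  (forall t : R, is_derive t 1 g (g' t)) ->
  (forall t : R, 0 <= t -> g' t <= a * g t + c * expR (b * t)) ->
  forall t : R, 0 <= t -> g t <= g 0 * expR (a * t) + c / (b - a) * expR (b * t).
Proof.
move=> ab c0 dg hg t t0.
pose e1 (s : R) := expR (- a * s); pose e2 (s : R) := expR ((b - a) * s).
pose h : R -> R := g * e1 - (c / (b - a)) *: e2.
have dh (s : R) : is_derive s 1 h ((g' s - a * g s - c * expR (b * s)) * expR (- a * s)).
  have de1 : is_derive s 1 e1 (- a * e1 s) := is_derive_expRM _ _.
  have de2 : is_derive s 1 e2 ((b - a) * e2 s) := is_derive_expRM _ _.
  apply: is_derive_eq.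
  have sE (x y : R) : x *: y = x * y by [].
  rewrite !sE mulrA divfK ?subr_eq0 ?gt_eqF //.
  have -> : e2 s = expR (b * s) * e1 s by rewrite /e1 /e2 -expRD; congr expR; ring.
  by rewrite -/(e1 s); ring.
have : h t <= h 0.
  apply: (@ler0_derive1_nincr _ h 0 t) => //.
  - move=> s; rewrite in_itv /= => /andP[s0 _].
    have dhs := dh s; rewrite derive1E derive_val.
    rewrite pmulr_lle0 ?expR_gt0 //.
    have := hg s (ltW s0); lra.
  - apply: continuous_subspaceT => s.
    by apply: differentiable_continuous; apply/derivable1_diffP; have dhs := dh s; exact: ex_derive.
rewrite /h !fctE /e1 /e2 /GRing.scale /= !mulr0 expR0 !mulr1 => hh.
have ba : 0 < b - a by rewrite subr_gt0.
have cb : 0 <= c / (b - a) by rewrite divr_ge0 // ltW.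
have {}hh : g t * expR (- a * t) <= g 0 + c / (b - a) * expR ((b - a) * t) by lra.
have := ler_wpM2r (expR_ge0 (a * t)) hh.
have -> : g t * expR (- a * t) * expR (a * t) = g t.
  by rewrite -mulrA -expRD mulNr addNr expR0 mulr1.
have -> : expR (b * t) = expR ((b - a) * t) * expR (a * t).
  by rewrite -expRD; congr expR; ring.
by rewrite mulrDl -!mulrA.
Qed.

Section exponential.
Context {R : realType} {d : nat}.
Local Notation V := 'M[R[i]]_d.
Implicit Types (A B : {linear V -> V}) (X Y : V) (k : bool * ('I_d * 'I_d)).

Lemma linear_scale A a X : A (a *: X) = a *: A X.
Proof. exact: linearZZ. Qed.

Lemma norm1_iter A (K : R) X n : 0 <= K -> (forall X, norm1 (A X) <= K * norm1 X) ->
  norm1 (iter n A X) <= K ^+ n * norm1 X.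
Proof.
move=> K0 hK; elim: n => [|n IH]; first by rewrite expr0 mul1r.
by rewrite iterS (le_trans (hK _)) // exprS -mulrA ler_wpM2l.
Qed.

Lemma iter_scaled A (t : R) X n :
  iter n (fun X => t%:C *: A X) X = (t ^+ n)%:C *: iter n A X.
Proof.
elim: n => [|n IH]; first by rewrite expr0 scale1r.
by rewrite !iterS IH linearZ /= scalerA -rmorphM -exprS.
Qed.

Definition exp_coef A X k (n : nat) : R := (n`!%:R)^-1 * rcoord k (iter n A X).

Lemma rcoord_exp_term A (t : R) X k n :
  rcoord k ((n`!%:R)^-1 *: iter n (fun X => t%:C *: A X) X)
  = exp_coef A X k n * t ^+ n.
Proof.
rewrite iter_scaled scalerA -(rmorph_nat (real_complex R)) -fmorphV -rmorphM.
by rewrite rcoordZ /exp_coef; ring.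
Qed.

Lemma norm_exp_coef A (K : R) X k n :
  0 <= K -> (forall X, norm1 (A X) <= K * norm1 X) ->
  `|exp_coef A X k n| <= K ^+ n / n`!%:R * norm1 X.
Proof.
move=> K0 hK; rewrite normrM ger0_norm ?invr_ge0 ?ler0n // mulrAC [leRHS]mulrC.
by rewrite ler_wpM2l ?invr_ge0 ?ler0n // (le_trans (rcoord_le_norm1 _ _)) // norm1_iter.
Qed.

Lemma cvg_exp_series A X k t : cvgn (pseries (exp_coef A X k) t).
Proof.
have [K /ltW K0 hK] := norm1_linear_bound A.
apply: normed_cvg.
pose w n := norm1 X * exp_coeff (K * `|t|) n.
apply: (@series_le_cvg _ _ w) => [n|n|n|].
- exact: normr_ge0.
- by rewrite /w mulr_ge0 ?norm1_ge0 // exp_coeff_ge0 // mulr_ge0.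
- rewrite /= normrM normrX /w /exp_coeff /= exprMn.
  have := @norm_exp_coef A K X k n K0 hK => /(ler_wpM2r (exprn_ge0 n (normr_ge0 t))).
  by move=> /le_trans; apply; rewrite le_eqVlt; apply/orP; left; apply/eqP; ring.
- by apply: is_cvg_seriesZ; exact: is_cvg_series_exp_coeff.
Qed.

(** Coordinatewise the series is a real power series in [t], dominated by that of
the exponential of [K * t], where [K] bounds the operator. *)
Lemma opexpt_series_cvg A t X :
  series (fun n => (n`!%:R)^-1 *: iter n (fun X => t%:C *: A X) X) @ \oo
    --> opexpt t A X.
Proof.
pose l (b : bool) i j := limn (pseries (exp_coef A X (b, (i, j))) t).
pose L : V := \matrix_(i, j) Complex (l true i j) (l false i j).
suff h : series (fun n => (n`!%:R)^-1 *: iter n (fun X => t%:C *: A X) X) @ \oo --> L.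
  by rewrite /opexpt /opexp (cvg_norm1_lim h).
apply/cvg_rcoordP => -[b [i j]].
have -> : rcoord (b, (i, j)) L = l b i j by rewrite /rcoord mxE; case: b.
rewrite (_ : (fun n => _) = pseries (exp_coef A X (b, (i, j))) t).
  exact: (@cvg_exp_series A X (b, (i, j)) t).
apply/funext => n; rewrite /series /= rcoord_sum; apply: eq_bigr => m _.
exact: rcoord_exp_term.
Qed.

Arguments opexpt_series_cvg : clear implicits.

Lemma rcoord_opexpt A t X k : rcoord k (opexpt t A X) = limn (pseries (exp_coef A X k) t).
Proof.
pose proof (cvg_rcoord (k := k) (opexpt_series_cvg A t X)) as h.
apply/esym/cvg_lim; first exact: Rhausdorff.
rewrite (_ : pseries _ _ = fun n => rcoord k (series (fun n =>
  (n`!%:R)^-1 *: iter n (fun X => t%:C *: A X) X) n)); first exact: h.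
apply/funext => n; rewrite /series /= rcoord_sum; apply: eq_bigr => m _.
by rewrite rcoord_exp_term.
Qed.

Lemma cvg_linear {T : Type} {F : set_system T} {FF : Filter F} (f : T -> V) (l : V)
    (B : {linear V -> V}) :
  f x @[x --> F] --> l -> B (f x) @[x --> F] --> B l.
Proof.
move=> /cvg_norm1P fl; apply/cvg_norm1P.
have [K K0 hK] := norm1_linear_bound B.
apply: (squeeze_cvgr (f := cst 0) (h := fun x => K * norm1 (f x - l))).
- by apply: nearW => x; rewrite norm1_ge0 /= -linearB hK.
- exact: cvg_cst.
- rewrite -[X in _ --> X](mulr0 K); apply: cvgMl_tmp; exact: fl.
Qed.

Arguments cvg_linear {T F FF f l} B.

Lemma cvg_addm {T : Type} {F : set_system T} {FF : Filter F} (f g : T -> V) (l m : V) :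
  f x @[x --> F] --> l -> g x @[x --> F] --> m ->
  f x + g x @[x --> F] --> l + m.
Proof.
move=> /cvg_rcoordP fl /cvg_rcoordP gm; apply/cvg_rcoordP => k; rewrite rcoordD.
under eq_cvg do rewrite rcoordD.
exact: cvgD (fl k) (gm k).
Qed.

Lemma iter_linear A n a X Y : iter n A (a *: X + Y) = a *: iter n A X + iter n A Y.
Proof. by elim: n => // n IH; rewrite !iterS IH linearP. Qed.

Fact opexpt_is_linear t A : linear (opexpt t A).
Proof.
move=> a X Y.
pose S Z := series (fun n => (n`!%:R)^-1 *: iter n (fun X => t%:C *: A X) Z : V).
pose proof (cvg_addm (cvg_linear ( *:%R a) (opexpt_series_cvg A t X))
   (opexpt_series_cvg A t Y)) as h.
suff e : (fun n => a *: S X n + S Y n) = S (a *: X + Y).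
  by rewrite /opexpt /opexp -/(S (a *: X + Y)) -e (cvg_norm1_lim h).
apply/funext => n; rewrite /S /series /= scaler_sumr -big_split /=.
apply: eq_bigr => m _.
by rewrite !iter_scaled iter_linear !scalerDr !scalerA; congr (_ *: _ + _); ring.
Qed.

HB.instance Definition _ t A :=
  GRing.isLinear.Build R[i] V V *:%R (opexpt t A) (opexpt_is_linear t A).

Lemma opexpt_comm A B t X : (forall X, A (B X) = B (A X)) ->
  opexpt t A (B X) = B (opexpt t A X).
Proof.
move=> AB; pose proof (cvg_linear B (opexpt_series_cvg A t X)) as h.
pose S Z := series (fun n => (n`!%:R)^-1 *: iter n (fun X => t%:C *: A X) Z : V).
suff e : (fun n => B (S X n)) = S (B X).
  by rewrite {1}/opexpt /opexp -/(S (B X)) -e (cvg_norm1_lim h).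
apply/funext => n; rewrite /S /series /= linear_sum /=; apply: eq_bigr => m _.
have e : iter m A (B X) = B (iter m A X) by elim: m => //= m ->; rewrite AB.
by rewrite !iter_scaled e !(linear_scale B).
Qed.

(** Termwise differentiation of the power series of a coordinate shifts the iterates
of [A] by one. *)
Lemma opexpt_deriv A X k (t : R) :
  is_derive t 1 (fun s => rcoord k (opexpt s A X)) (rcoord k (opexpt t A (A X))).
Proof.
have e Y : pseries_diffs (exp_coef A Y k) = exp_coef A (A Y) k.
  apply/funext => n; rewrite /pseries_diffs /exp_coef factS natrM invfM iterSr.
  by rewrite mulrA mulrA divff ?mul1r // pnatr_eq0.
suff : is_derive t 1 (fun s => rcoord k (opexpt s A X))
    (limn (pseries (pseries_diffs (exp_coef A X k)) t)) by rewrite e -rcoord_opexpt.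
rewrite (_ : (fun s => _) = (fun s => limn (pseries (exp_coef A X k) s))); last first.
  by apply/funext => s; rewrite rcoord_opexpt.
apply: (@pseries_snd_diffs _ _ (`|t| + 1)); rewrite ?e; try exact: cvg_exp_series.
by rewrite [ltRHS]ger0_norm ?addr_ge0 // ltrDl.
Qed.

Lemma opexpt_comm_self A t X : opexpt t A (A X) = A (opexpt t A X).
Proof. exact: opexpt_comm. Qed.

Lemma lim_dist_le (u : R^nat) (a b : R) (N : nat) : cvgn u ->
  (forall n, (N <= n)%N -> `|u n - a| <= b) -> `|limn u - a| <= b.
Proof.
move=> cu hu; rewrite ler_distl; apply/andP; split.
  apply: limr_ge => //; near=> n.
  by have := hu n; rewrite ler_distl => /(_ _)/andP[//|]; near: n; exists N.
apply: limr_le => //; near=> n.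
by have := hu n; rewrite ler_distl => /(_ _)/andP[//|]; near: n; exists N.
Unshelve. all: by end_near. Qed.

Lemma sum_exp_coeff_le (x : R) n : 0 <= x ->
  \sum_(0 <= i < n) exp_coeff x i <= expR x.
Proof.
move=> x0; apply: (@nondecreasing_cvgn_le _ (series (exp_coeff x))).
  by apply: nondecreasing_series => i _ _; exact: exp_coeff_ge0.
exact: is_cvg_series_exp_coeff.
Qed.

Lemma opexpt0 A X : opexpt 0 A X = X.
Proof.
apply: rcoord_inj => k; rewrite rcoord_opexpt; apply/eqP.
rewrite -subr_eq0 -normr_le0; apply: (@lim_dist_le _ _ _ 1); first exact: cvg_exp_series.
move=> [|n] // _; rewrite /pseries /series /= big_nat_recl //.
rewrite big1 => [|i _]; last by rewrite expr0n mulr0.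
by rewrite /exp_coef /= invr1 mul1r mulr1 addr0 subrr normr0.
Qed.

Lemma opexpt_bound A (t : R) : 0 <= t ->
  exists2 C : R, 0 < C &
    forall s X, 0 <= s <= t -> norm1 (opexpt s A X) <= C * norm1 X.
Proof.
move=> t0; have [K /ltW K0 hK] := norm1_linear_bound A.
set N := #|{: bool * ('I_d * 'I_d)}|.
(* Each of the [N] coordinates is at most [expR (K * t) * norm1 X]; adding 1 keeps the
   constant positive when there are no coordinates. *)
exists (N%:R * expR (K * t) + 1); first by rewrite ltr_wpDl // mulr_ge0 ?expR_ge0.
move=> s X /andP[s0 st].
apply: (@le_trans _ _ (N%:R * expR (K * t) * norm1 X)); last first.
  by rewrite ler_wpM2r ?norm1_ge0 // lerDl.
rewrite {1}/norm1 -mulrA mulr_natl -sumr_const; apply: ler_sum => k _.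
rewrite rcoord_opexpt -[limn _]subr0; apply: (@lim_dist_le _ _ _ 0); first exact: cvg_exp_series.
move=> n _; rewrite subr0 (le_trans (ler_norm_sum _ _ _)) //.
apply: (@le_trans _ _ ((\sum_(0 <= i < n) exp_coeff (K * t) i) * norm1 X)); last first.
  by rewrite ler_wpM2r ?norm1_ge0 ?sum_exp_coeff_le ?mulr_ge0.
rewrite mulr_suml; apply: ler_sum => i _.
rewrite normrM normrX (ger0_norm s0) /exp_coeff /= exprMn.
apply: (@le_trans _ _ (K ^+ i / i`!%:R * norm1 X * t ^+ i)).
  apply: ler_pM; rewrite ?exprn_ge0 ?normr_ge0 ?norm_exp_coef //.
  by rewrite lerXn2r ?nnegrE.
by rewrite le_eqVlt; apply/orP; left; apply/eqP; ring.
Qed.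

(** For [h <= 1] every term of order at least two carries a factor [h ^+ 2], and the
remaining series is bounded by an exponential. *)
Lemma opexpt_taylor2 A : exists2 C : R, 0 < C &
  forall h X, 0 <= h <= 1 ->
    norm1 (opexpt h A X - X - h%:C *: A X) <= C * h ^+ 2 * norm1 X.
Proof.
have [K /ltW K0 hK] := norm1_linear_bound A.
set N := #|{: bool * ('I_d * 'I_d)}|.
exists (N%:R * expR K + 1); first by rewrite ltr_wpDl // mulr_ge0 ?expR_ge0.
move=> h X /andP[h0 h1].
apply: (@le_trans _ _ (N%:R * (expR K * h ^+ 2 * norm1 X))); last first.
  have -> : (N%:R * expR K + 1) * h ^+ 2 * norm1 X
    = N%:R * (expR K * h ^+ 2 * norm1 X) + h ^+ 2 * norm1 X by ring.
  by rewrite lerDl mulr_ge0 ?sqr_ge0 ?norm1_ge0.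
rewrite {1}/norm1 mulr_natl -sumr_const; apply: ler_sum => k _.
rewrite !rcoordB rcoordZ rcoord_opexpt -addrA -opprD.
apply: (@lim_dist_le _ _ _ 2); first exact: cvg_exp_series.
move=> [|[|n]] // _; rewrite /pseries /series /=.
rewrite big_nat_recl // big_nat_recl //.
have -> : exp_coef A X k 0 = rcoord k X by rewrite /exp_coef invr1 mul1r.
have -> : exp_coef A X k 1 = rcoord k (A X) by rewrite /exp_coef invr1 mul1r.
set S := \sum_(0 <= i < n) _; rewrite (_ : _ - _ = S); last by ring.
rewrite (le_trans (ler_norm_sum _ _ _)) //.
apply: (@le_trans _ _ ((\sum_(0 <= i < n) exp_coeff K i.+2) * (h ^+ 2 * norm1 X))); last first.
  rewrite -mulrA ler_wpM2r ?mulr_ge0 ?norm1_ge0 ?sqr_ge0 //.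
  rewrite (le_trans _ (sum_exp_coeff_le n.+2 K0)) //.
  by rewrite [leRHS]big_nat_recl // [X in _ <= _ + X]big_nat_recl // addrA lerDr
     addr_ge0 // exp_coeff_ge0.
rewrite mulr_suml; apply: ler_sum => i _.
rewrite normrM normrX (ger0_norm h0) /exp_coeff /=.
apply: (@le_trans _ _ (K ^+ i.+2 / i.+2`!%:R * norm1 X * h ^+ 2)).
  apply: ler_pM; rewrite ?exprn_ge0 ?normr_ge0 ?norm_exp_coef //.
  by rewrite -addn2 addnC exprD ler_piMr ?sqr_ge0 ?exprn_ile1.
by rewrite le_eqVlt; apply/orP; left; apply/eqP; ring.
Qed.

Lemma sqr_norm1_le X :
  norm1 X ^+ 2 <= #|{: bool * ('I_d * 'I_d)}|%:R * \sum_k rcoord k X ^+ 2.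
Proof.
rewrite expr2 {1}/norm1 mulr_suml.
apply: (@le_trans _ _ (\sum_k \sum_l (rcoord k X ^+ 2 + rcoord l X ^+ 2) / 2)).
  apply: ler_sum => k _; rewrite /norm1 mulr_sumr; apply: ler_sum => l _.
  have := sqr_ge0 (`|rcoord k X| - `|rcoord l X|).
  by rewrite -[rcoord k X ^+ 2]real_normK ?num_real // -[rcoord l X ^+ 2]real_normK ?num_real //; lra.
set N : R := _%:R; set S := \sum_k rcoord k X ^+ 2.
rewrite le_eqVlt; apply/orP; left; apply/eqP.
transitivity (\sum_k (N * rcoord k X ^+ 2 + S) / 2).
  apply: eq_bigr => k _; rewrite -mulr_suml big_split /= sumr_const -/S.
  by rewrite -[_ *+ _]mulr_natl.
by rewrite -mulr_suml big_split /= -mulr_sumr sumr_const -[S *+ _]mulr_natl -/N -/S; field.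
Qed.

(** The energy of the difference, that is the sum of the squares of its coordinates,
vanishes at 0 and satisfies a linear differential inequality. *)
Lemma opexpt_unique A (u : R -> V) :
  (forall (t : R) k, is_derive t 1 (fun s => rcoord k (u s)) (rcoord k (A (u t)))) ->
  forall t, 0 <= t -> u t = opexpt t A (u 0).
Proof.
move=> du t t0; have [K /ltW K0 hK] := norm1_linear_bound A.
pose w s := u s - opexpt s A (u 0).
have dw (s : R) k : is_derive s 1 (fun s => rcoord k (w s)) (rcoord k (A (w s))).
  rewrite /w linearB rcoordB -opexpt_comm_self.
  rewrite (_ : (fun _ => _) =
    (fun s => rcoord k (u s)) - (fun s => rcoord k (opexpt s A (u 0)))); last first.
    by apply/funext => r; rewrite rcoordB.
  have d1 := du s k; have d2 := opexpt_deriv A (u 0) k s.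
  exact: is_deriveB.
pose g s := \sum_k rcoord k (w s) ^+ 2.
pose g' s := \sum_k 2 * (rcoord k (w s) * rcoord k (A (w s))).
have dg (s : R) : is_derive s 1 g (g' s).
  apply: is_derive_bigsum => k; have d1 := dw s k.
  rewrite (_ : (fun _ => _) = (fun s => rcoord k (w s)) * (fun s => rcoord k (w s))); last first.
    by apply/funext => r; rewrite expr2.
  apply: (is_derive_eq (is_deriveM d1 d1)).
  have sE (x y : R) : x *: y = x * y by [].
  by rewrite !sE; ring.
set N : R := #|{: bool * ('I_d * 'I_d)}|%:R.
pose a := 2 * K * N.
have hg (s : R) : 0 <= s -> g' s <= a * g s + 0 * expR ((a + 1) * s).
  move=> _; rewrite mul0r addr0.
  apply: (@le_trans _ _ (2 * K * norm1 (w s) ^+ 2)); last first.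
    by rewrite /a -[leRHS]mulrA ler_wpM2l ?mulr_ge0 // sqr_norm1_le.
  rewrite /g' -mulr_sumr -mulrA ler_wpM2l // expr2 mulrA.
  apply: (@le_trans _ _ (\sum_k `|rcoord k (w s)| * (K * norm1 (w s)))).
    apply: ler_sum => k _; apply: (le_trans (ler_norm _)).
    by rewrite normrM ler_wpM2l // (le_trans (rcoord_le_norm1 _ _)).
  by rewrite -mulr_suml -/(norm1 (w s)) mulrCA mulrA.
have aa : a < a + 1 by rewrite ltrDl.
have := gronwall aa (lexx 0) dg hg t0; rewrite mul0r mul0r addr0.
have -> : g 0 = 0.
  by rewrite /g big1 // => k _; rewrite /w opexpt0 subrr rcoord0 expr0n.
rewrite mul0r => g0; apply/eqP; rewrite -subr_eq0; apply/eqP/rcoord_inj => k.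
rewrite rcoord0; apply/eqP; rewrite -sqrf_eq0 eq_le sqr_ge0 andbT.
apply: le_trans g0; rewrite /g (bigD1 k) //= lerDl sumr_ge0 // => l _.
exact: sqr_ge0.
Qed.

(** Both sides solve the same linear differential equation in [s]. *)
Lemma opexptD A (s t : R) X : 0 <= s ->
  opexpt (s + t) A X = opexpt s A (opexpt t A X).
Proof.
move=> s0.
have du (r : R) k : is_derive r 1 (fun r => rcoord k (opexpt (r + t) A X))
    (rcoord k (A (opexpt (r + t) A X))).
  rewrite -opexpt_comm_self.
  have d1 := opexpt_deriv A X k (r + t).
  have d2 : is_derive r 1 (fun r => r + t) 1.
    rewrite (_ : (fun r => r + t) = id + cst t) //.
    by apply: is_derive_eq; rewrite addr0.
  pose proof (@is_derive1_comp R (fun s => rcoord k (opexpt s A X)) (fun r => r + t)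
    r _ _ d1 d2) as d3.
  by move: d3; rewrite /comp mulr1.
by rewrite (opexpt_unique du s0) add0r.
Qed.

Lemma opexpt_cst A (t : R) X : 0 <= t -> A X = 0 -> opexpt t A X = X.
Proof.
move=> t0 AX; suff du (s : R) k : is_derive s 1 (fun=> rcoord k X) (rcoord k (A X)).
  by rewrite -(@opexpt_unique A (fun=> X) du t t0).
by rewrite AX rcoord0; exact: is_derive_cst.
Qed.

Lemma opexpt_affine A (t : R) X : 0 <= t -> A (A X) = 0 ->
  opexpt t A X = X + t%:C *: A X.
Proof.
move=> t0 AX.
suff du (s : R) k : is_derive s 1 (fun s => rcoord k (X + s%:C *: A X))
    (rcoord k (A (X + s%:C *: A X))).
  by rewrite -[X in opexpt t A X](_ : X + 0%:C *: A X = X) -?(opexpt_unique du t0) //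
    scale0r addr0.
rewrite linearD linearZ /= AX scaler0 addr0.
rewrite (_ : (fun _ => _) = cst (rcoord k X) + (id : R -> R) * cst (rcoord k (A X))); last first.
  by apply/funext => r; rewrite rcoordD rcoordZ.
apply: (is_derive_eq (is_deriveD (is_derive_cst _ _ _)
  (is_deriveM (is_derive_id _ _) (is_derive_cst _ _ _)))).
have sE (x y : R) : x *: y = x * y by [].
by rewrite !sE mulr0 !add0r mulr1.
Qed.

Lemma opexpt_ext (f g : V -> V) (t : R) : f =1 g -> opexpt t f = opexpt t g.
Proof. by move=> /funext ->. Qed.

Lemma opexpt_scaleE (f : V -> V) (c t : R) :
  opexpt t (fun X => c%:C *: f X) = opexpt (t * c) f.
Proof.
rewrite /opexpt; congr opexp; apply/funext => X.
by rewrite scalerA -rmorphM.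
Qed.

End exponential.

(** * Positive semidefinite matrices *)

Section positivity.
Local Open Scope sesquilinear_scope.
Context {R : realType}.
Local Notation C := R[i].

Lemma psdmx_congr m n (U : 'M[C]_(m, n)) (B : 'M[C]_m) :
  psdmx B -> psdmx (U^t* *m B *m U).
Proof.
move=> hB v; have := hB (U *m v).
by rewrite trmx_mul map_mxM !mulmxA.
Qed.

(** The relabelled matrix is congruent to [B] through a 0-1 matrix; [f] may be any
function, so this covers both directions of a reindexing. *)
Lemma psdmx_mxsub m n (f : 'I_n -> 'I_m) (B : 'M[C]_m) :
  psdmx B -> psdmx (mxsub f f B).
Proof.
move=> /(psdmx_congr (colsub f 1%:M)).
have -> : (colsub f (1%:M : 'M[C]_m))^t* = rowsub f 1%:M.
  apply/matrixP => i j; rewrite !mxE /= eq_sym.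
  by case: eqP => _; rewrite ?conjC1 ?conjC0.
by rewrite mul_rowsub_mx mul1mx mulmx_colsub mulmx1 -mxsubcr.
Qed.

Lemma psdmx_rank1 n (v : 'cV[C]_n) : psdmx (v *m v^t*).
Proof.
move=> w; rewrite !mulmxA -mulmxA [X in 0 <= X]mxE big_ord1.
have -> : (w^t* *m v) 0 0 = ((v^t* *m w) 0 0)^*%R.
  rewrite !mxE rmorph_sum; apply: eq_bigr => k _.
  by rewrite !mxE /= rmorphM /= conjCK mulrC.
by rewrite mulrC mul_conjC_ge0.
Qed.

Lemma psdmx_quadratic n (B : 'M[C]_n) (i j : 'I_n) (c : C) : psdmx B ->
  0 <= B i i + c * B i j + c^*%R * B j i + c^*%R * c * B j j.
Proof.
move=> /(_ (delta_mx i 0 + c *: delta_mx j 0)).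
have -> : (delta_mx i 0 + c *: delta_mx j 0 : 'cV[C]_n)^t*
    = delta_mx 0 i + c^*%R *: delta_mx 0 j.
  apply/matrixP => a b; rewrite !mxE rmorphD rmorphM /= !rmorph_nat.
  by rewrite [in X in X + _]andbC [in X in _ * X]andbC.
rewrite mulmxDl mulmxDl mulmxDr !mulmxDr -!scalemxAl -!scalemxAr -!rowE -!colE.
rewrite !mxE; move=> h; rewrite (le_trans h) // le_eqVlt; apply/orP; left; apply/eqP.
ring.
Qed.

Lemma psdmx_diag_ge0 n (B : 'M[C]_n) i : psdmx B -> 0 <= B i i.
Proof.
move=> hB; have := psdmx_quadratic i i 0 hB.
by rewrite rmorph0 !mul0r !addr0.
Qed.

(** Test positivity on [e_i + c e_j] for the four fourth roots of unity [c]: this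
bounds [B i j + B j i] and [B i j - B j i] by the two diagonal entries. *)
Lemma psdmx_entry_le_tr n (B : 'M[C]_n) i j : psdmx B ->
  cabs1 (B i j) <= 2 * complex.Re (\tr B).
Proof.
move=> hB.
have hd k : 0 <= complex.Re (B k k) <= complex.Re (\tr B).
  have := psdmx_diag_ge0 k hB; rewrite lecE /= => /andP[_ ->] /=.
  rewrite /mxtrace (bigD1 k) //= complex_ReD lerDl.
  have : 0 <= \sum_(l < n | l != k) B l l.
    by apply: sumr_ge0 => l _; exact: psdmx_diag_ge0.
  by rewrite lecE => /andP[].
have h1 := psdmx_quadratic i j 1 hB.
have h2 := psdmx_quadratic i j (-1) hB.
have h3 := psdmx_quadratic i j 'i%C hB.
have h4 := psdmx_quadratic i j (- 'i%C) hB.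
move: h1 h2 h3 h4 (hd i) (hd j).
rewrite !rmorphN !rmorph1 complexiE conjCi -complexiE /=.
case: (B i i) (B j j) (B i j) (B j i) => [a a'] [b b'] [p p'] [q q'].
rewrite !lecE /= /cabs1 /=.
move=> /andP[/eqP h1 g1] /andP[/eqP h2 g2] /andP[/eqP h3 g3] /andP[/eqP h4 g4] /andP[a0 a1] /andP[b0 b1].
have : `|p| <= complex.Re (\tr B) by rewrite ler_norml; apply/andP; split; lra.
have : `|p'| <= complex.Re (\tr B) by rewrite ler_norml; apply/andP; split; lra.
lra.
Qed.

End positivity.

(** * Contractivity of completely positive trace-preserving semigroups *)

Section gauge.
Local Open Scope sesquilinear_scope.
Context {R : realType} {d : nat}.
Local Notation C := R[i].
Local Notation V := 'M[C]_d.
Implicit Types (A B L Phi : {linear V -> V}) (X Y : V).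

Definition positive_tp Phi : Prop :=
  (forall X, psdmx X -> psdmx (Phi X)) /\ trace_preserving Phi.

(** A block matrix with a single block is that block up to a relabelling of its
indices. *)
Lemma cp_positive (Phi : V -> V) X :
  completely_positive Phi -> psdmx X -> psdmx (Phi X).
Proof.
move=> cpPhi hX.
have /cpPhi : psdmx (@mxblock _ 1 1 (fun=> d) (fun=> d) (fun _ _ => X)).
  rewrite (_ : mxblock _ = mxsub (@tagnat.sig2 1 (fun=> d)) (@tagnat.sig2 1 (fun=> d)) X).
    exact: psdmx_mxsub.
  by apply/matrixP => i j; rewrite !mxE.
move=> /(psdmx_mxsub (@tagnat.Rank 1 (fun=> d) ord0)).
by rewrite -[mxsub _ _ _]/(submxblock _ _ _) mxblockK.
Qed.

(** The rank-one positive semidefinite matrix of the vector [e_i + c e_j]. *)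
Definition polar i j (c : C) : V :=
  (delta_mx i 0 + c *: delta_mx j 0) *m (delta_mx i 0 + c *: delta_mx j 0 : 'cV[C]_d)^t*.

Lemma polarization i j :
  delta_mx i j = (4%:R^-1)%:C *: (polar i j 1 - polar i j (-1)
    + 'i%C *: (polar i j 'i%C - polar i j (- 'i%C))).
Proof.
have pE c : polar i j c = delta_mx i i + c^*%R *: delta_mx i j
    + c *: delta_mx j i + (c * c^*%R) *: delta_mx j j.
  rewrite /polar.
  have -> : (delta_mx i 0 + c *: delta_mx j 0 : 'cV[C]_d)^t*
      = delta_mx 0 i + c^*%R *: delta_mx 0 j.
    apply/matrixP => a b; rewrite !mxE rmorphD rmorphM /= !rmorph_nat.
    by rewrite [in X in X + _]andbC [in X in _ * X]andbC.
  rewrite mulmxDl !mulmxDr -!scalemxAl -!scalemxAr scalerA !mul_delta_mx.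
  by rewrite -!addrA; congr (_ + (_ + _)); rewrite addrA.
have ii : 'i%C * 'i%C = -1 :> C by rewrite -expr2 sqr_i.
have ic : ('i%C : C)^*%R = - 'i%C by rewrite complexiE conjCi.
rewrite !pE !rmorphN !rmorph1 /= ic.
apply/matrixP => a b; rewrite !mxE.
move: ((a == i) && (b == i))%:R ((a == i) && (b == j))%:R
  ((a == j) && (b == i))%:R ((a == j) && (b == j))%:R => w x y z.
have f4 : (4%:R^-1)%:C * 4%:R = 1 :> C.
  by rewrite fmorphV /= rmorph_nat mulVf // pnatr_eq0.
transitivity ((4%:R^-1)%:C * 4%:R * x); first by rewrite f4 mul1r.
rewrite -mulrA; congr (_ * _). ring: ii.
Qed.

(** By polarization a matrix unit is a combination of four positive semidefinite
matrices; their images are positive semidefinite with the same traces, and the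
trace controls the entries. *)
Lemma positive_tp_bound : exists2 c : R, 0 < c &
  forall Phi X, positive_tp Phi -> norm1 (Phi X) <= c * norm1 X.
Proof.
pose N : R := #|{: 'I_d * 'I_d}|%:R.
pose tr i j c := N * (2 * complex.Re (\tr (polar i j c))).
have trP Phi i j c : positive_tp Phi -> norm1 (Phi (polar i j c)) <= tr i j c.
  move=> [posPhi trPhi].
  rewrite norm1E pair_bigA /= /tr /N mulr_natl -sumr_const.
  apply: ler_sum => -[k l] _ /=.
  by rewrite -trPhi; apply/psdmx_entry_le_tr/posPhi/psdmx_rank1.
pose b i j := `|4^-1| * (tr i j 1 + tr i j (-1) + (tr i j 'i%C + tr i j (- 'i%C))).
have bP Phi i j : positive_tp Phi -> norm1 (Phi (delta_mx i j)) <= b i j.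
  move=> hPhi; rewrite polarization linearZ linearD linearB linearZ linearB /=.
  rewrite norm1Zr ler_wpM2l // (le_trans (norm1D _ _)) // lerD //.
    by rewrite (le_trans (norm1B _ _)) // lerD // trP.
  rewrite (le_trans (norm1Z _ _)) // /cabs1 /= normr0 normr1 add0r mul1r.
  by rewrite (le_trans (norm1B _ _)) // lerD // trP.
exists (1 + \sum_i \sum_j `|b i j|).
  by rewrite ltr_pwDl // sumr_ge0 // => i _; rewrite sumr_ge0.
move=> Phi X hPhi; rewrite (le_trans (norm1_linear_le _ _)) //.
rewrite ler_wpM2r ?norm1_ge0 // ler_wpDl // ler_sum // => i _.
by rewrite ler_sum // => j _; rewrite (le_trans (bP _ _ _ hPhi)) ?ler_norm.
Qed.

(** The ball of radius [r] of the norm sup_Phi [norm1 (Phi X)], where Phi runs over the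
positive trace-preserving maps; each of these maps contracts this norm because
they are closed under composition. Speaking of balls avoids forming the supremum. *)
Definition gauge_le X (r : R) : Prop := forall Phi, positive_tp Phi -> norm1 (Phi X) <= r.

Lemma gauge_le_norm1 X r : gauge_le X r -> norm1 X <= r.
Proof. by move=> /(_ idfun); apply; split. Qed.

Lemma gauge_le_map Phi X r : positive_tp Phi -> gauge_le X r -> gauge_le (Phi X) r.
Proof.
move=> [posPhi trPhi] hX Psi [posPsi trPsi].
apply: (hX (Psi \o Phi)); split=> [Y /posPhi/posPsi //|Y].
by rewrite /= trPsi trPhi.
Qed.

Lemma gauge_leD X Y r s : gauge_le X r -> gauge_le Y s -> gauge_le (X + Y) (r + s).
Proof.
move=> hX hY Phi hPhi; rewrite linearD (le_trans (norm1D _ _)) //.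
by rewrite lerD ?hX ?hY.
Qed.

Lemma gauge_leZ X r a : 0 <= a -> gauge_le X r -> gauge_le (a%:C *: X) (a * r).
Proof.
by move=> a0 hX Phi hPhi; rewrite linearZ norm1Zr ger0_norm // ler_wpM2l ?hX.
Qed.

Lemma gauge_le_weaken X r s : r <= s -> gauge_le X r -> gauge_le X s.
Proof. by move=> rs hX Phi hPhi; rewrite (le_trans _ rs) ?hX. Qed.

Lemma gauge_le_ge0 X r : gauge_le X r -> 0 <= r.
Proof. by move=> /gauge_le_norm1; apply: le_trans; exact: norm1_ge0. Qed.

(** First-order contractivity of [1 + h L] for the norm described by [gauge_le]. It
only involves the generator, which is what makes it additive. *)
Definition dissipative (L : V -> V) : Prop := forall e : R, 0 < e ->
  exists2 dl : R, 0 < dl & forall h X r, 0 < h < dl ->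
    gauge_le X r -> gauge_le (X + h%:C *: L X) ((1 + e * h) * r).

(** The semigroup contracts the gauge and agrees with [1 + h L] up to an error that
is [o(h)] uniformly on bounded sets, since it is [o(h)] on the matrix units. *)
Lemma lindbladian_dissipative L : lindbladian L -> dissipative L.
Proof.
move=> [T [T0 TD Tc Tcp Ttp] TL] e e0.
have [c c0 hc] := positive_tp_bound.
pose N : R := #|{: 'I_d * 'I_d}|%:R.
pose eta := e / c / (N + 1).
have N0 : 0 <= N by [].
have eta0 : 0 < eta by rewrite !divr_gt0 // ltr_wpDl.
have : \forall h \near 0^'+, forall ij : 'I_d * 'I_d,
    norm1 ((h%:C)^-1 *: (T h (delta_mx ij.1 ij.2) - delta_mx ij.1 ij.2)
         - L (delta_mx ij.1 ij.2)) < eta.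
  apply: filter_forall => ij.
  move/cvg_norm1P : (TL (delta_mx ij.1 ij.2)) => /cvgr0Pnorm_lt/(_ eta eta0).
  by apply: filterS => h; rewrite ger0_norm // norm1_ge0.
move=> [dl dl0 near_dl]; exists dl => // h X r /andP[h0 hdl] hX.
have {}near_dl ij : norm1 ((h%:C)^-1 *: (T h (delta_mx ij.1 ij.2) - delta_mx ij.1 ij.2)
         - L (delta_mx ij.1 ij.2)) < eta.
  by apply: near_dl => //; rewrite /ball /= sub0r normrN gtr0_norm.
have [|D DE] := @linear_lift R d (fun Y => (h%:C)^-1 *: (T h Y - Y) - L Y).
  move=> a Y Z; rewrite (linearP (T h)) (linearP L).
  move: (T h Y) (T h Z) (L Y) (L Z) => Y1 Z1 Y2 Z2.
  by apply/matrixP => k l; rewrite !mxE; ring.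
have hD : norm1 (D X) <= e / c * norm1 X.
  rewrite (le_trans (norm1_linear_le _ _)) // ler_wpM2r ?norm1_ge0 //.
  apply: (@le_trans _ _ (N * eta)).
    rewrite pair_bigA /= /N mulr_natl -sumr_const ler_sum // => ij _.
    by rewrite DE ltW.
  rewrite /eta mulrCA ler_piMr ?divr_ge0 ?(ltW e0) ?(ltW c0) //.
  by rewrite ler_pdivrMr ?mul1r ?lerDl // ltr_wpDl.
have -> : X + h%:C *: L X = T h X + h%:C *: (- D X).
  rewrite DE opprB scalerBr scalerA divff ?scale1r.
    by rewrite addrC [in RHS]addrC -addrA; congr (_ + _); rewrite opprB subrK.
  by rewrite -(rmorph0 (real_complex R)) (inj_eq (@complexI R)) gt_eqF.
rewrite mulrDl mul1r mulrAC [e * _ * h]mulrC; apply: gauge_leD.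
  apply: gauge_le_map hX; split=> [Y|]; last exact: Ttp (ltW h0).
  by apply: cp_positive; apply: Tcp; exact: ltW.
apply: gauge_leZ (ltW h0) _ => Phi hPhi.
rewrite (le_trans (hc _ _ hPhi)) // norm1N.
rewrite -ler_pdivlMl // mulrC mulrAC (le_trans hD) //.
by rewrite ler_wpM2l ?divr_ge0 ?(ltW e0) ?(ltW c0) ?gauge_le_norm1.
Qed.

End gauge.

Section contraction.
Context {R : realType} {d : nat}.
Local Notation C := R[i].
Local Notation V := 'M[C]_d.
Implicit Types (A B L : {linear V -> V}) (X Y : V).

(** [X + h (f X + g X)] is the midpoint of [X + 2 h f X] and [X + 2 h g X]. *)
Lemma dissipativeD (f g : V -> V) :
  dissipative f -> dissipative g -> dissipative (fun X => f X + g X).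
Proof.
move=> df dg e e0.
have e2 : 0 < e / 2 by rewrite divr_gt0.
have [a a0 fa] := df _ e2; have [b b0 gb] := dg _ e2.
exists (Num.min a b / 2); first by rewrite divr_gt0 // lt_min a0 b0.
move=> h X r /andP[h0]; rewrite ltr_pdivlMr // lt_min => /andP[ha hb] hX.
have h20 : 0 < h * 2 by rewrite mulr_gt0.
have fX := fa (h * 2) X r; rewrite h20 ha in fX.
have gX := gb (h * 2) X r; rewrite h20 hb in gX.
have half : 0 <= 2^-1 :> R by rewrite invr_ge0.
have := gauge_leD (gauge_leZ half (fX isT hX)) (gauge_leZ half (gX isT hX)).
rewrite !scalerDr !scalerA -!rmorphM /= mulrC mulfK // => H.
rewrite (_ : X + _ = (2^-1)%:C *: X + h%:C *: f X + ((2^-1)%:C *: X + h%:C *: g X)).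
  by apply: gauge_le_weaken H; rewrite le_eqVlt; apply/orP; left; apply/eqP; field.
rewrite addrACA -scalerDl -rmorphD /=.
have -> : 2^-1 + 2^-1 = 1 :> R by field.
by rewrite scale1r -scalerDr.
Qed.

Lemma dissipativeZ (c : R) (f : V -> V) :
  0 < c -> dissipative f -> dissipative (fun X => c%:C *: f X).
Proof.
move=> c0 df e e0; have [a a0 fa] := df (e / c) (divr_gt0 e0 c0).
exists (a / c); first by rewrite divr_gt0.
move=> h X r /andP[h0]; rewrite ltr_pdivlMr // => ha hX.
have fX := fa (h * c) X r; rewrite mulr_gt0 // ha in fX.
rewrite scalerA -rmorphM /=; apply: gauge_le_weaken (fX isT hX).
by rewrite le_eqVlt; apply/orP; left; apply/eqP; field; rewrite gt_eqF.
Qed.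

(** The exponential differs from [1 + h A] by a term of order [h ^+ 2]. *)
Lemma opexpt_short_gauge A : dissipative A -> forall e : R, 0 < e ->
  exists2 dl : R, 0 < dl & forall h X r, 0 < h < dl ->
    gauge_le X r -> gauge_le (opexpt h A X) ((1 + e * h) * r).
Proof.
move=> dA e e0; have e2 : 0 < e / 2 by rewrite divr_gt0.
have [a a0 Aa] := dA _ e2; have [c c0 hc] := @positive_tp_bound R d.
have [K K0 hK] := opexpt_taylor2 A.
have cK0 : 0 < c * K by rewrite mulr_gt0.
exists (Num.min a (Num.min 1 (e / 2 / (c * K)))).
  by rewrite !lt_min a0 ltr01 divr_gt0.
move=> h X r /andP[h0]; rewrite !lt_min => /andP[ha /andP[h1 hK']] hX.
have r0 := gauge_le_ge0 hX; have Xr := gauge_le_norm1 hX.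
have -> : opexpt h A X = (X + h%:C *: A X) + (opexpt h A X - X - h%:C *: A X).
  by rewrite -[X in _ + X]addrA -opprD [RHS]addrC subrK.
apply: (@gauge_le_weaken _ _ _ ((1 + e / 2 * h) * r + e / 2 * h * r)).
  by rewrite le_eqVlt; apply/orP; left; apply/eqP; field.
apply: gauge_leD; first by apply: Aa; rewrite ?h0 ?ha.
move=> Phi hPhi; rewrite (le_trans (hc _ _ hPhi)) //.
have := hK h X; rewrite (ltW h0) (ltW h1) => /(_ isT) H.
have {}H := ler_wpM2l (ltW c0) H; apply: (le_trans H).
move: hK'; rewrite ltr_pdivlMr // => hK'.
rewrite (_ : c * _ = h * (c * K) * h * norm1 X); last by ring.
have hh : h * (c * K) * h <= e / 2 * h by rewrite ler_pM2r // ltW.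
by apply: ler_pM => //; rewrite ?norm1_ge0 // ?mulr_ge0 // ltW.
Qed.

Lemma opexpt_iter A (h : R) X n : 0 <= h ->
  iter n (opexpt h A) X = opexpt (n%:R * h) A X.
Proof.
move=> h0; elim: n => [|n IH]; first by rewrite mul0r opexpt0.
have -> : n.+1%:R * h = h + n%:R * h by rewrite -nat1r mulrDl mul1r.
apply: etrans (esym (opexptD A (n%:R * h) X h0)).
exact: (congr1 (opexpt h A) IH).
Qed.

(** Cut [t] into [n] steps: each expands the gauge by at most [1 + e * t / n], so all
of them together by at most [expR (e * t)], for every [e > 0]. *)
Lemma opexpt_gauge A (t : R) X r : dissipative A -> 0 <= t ->
  gauge_le X r -> gauge_le (opexpt t A X) r.
Proof.
move=> dA; rewrite le_eqVlt => /predU1P[<-|t0] hX; first by rewrite opexpt0.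
have r0 := gauge_le_ge0 hX.
have key e : 0 < e -> gauge_le (opexpt t A X) (expR (e * t) * r).
  move=> e0; have [dl dl0 hdl] := opexpt_short_gauge dA e0.
  (* With this many steps each one is shorter than [dl]. *)
  pose n := (Num.truncn (t / dl)).+1.
  have n0 : 0 < n%:R :> R by rewrite ltr0n.
  pose h := t / n%:R.
  have h0 : 0 < h by rewrite divr_gt0.
  have hl : h < dl.
    by rewrite ltr_pdivrMr // mulrC -ltr_pdivrMr // truncnS_gt.
  have -> : t = n%:R * h by rewrite mulrC divfK // gt_eqF.
  rewrite -opexpt_iter ?(ltW h0) // mulrCA expRM_natl.
  elim: (n) => [|m IH]; first by rewrite mul1r.
  rewrite iterS exprS -mulrA.
  have := hdl h _ _ _ IH; rewrite h0 hl => /(_ isT).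
  apply: gauge_le_weaken; rewrite ler_wpM2r ?expR_ge1Dx //.
  by rewrite mulr_ge0 // exprn_ge0 // expR_ge0.
move=> Phi hPhi; apply/ler_addgt0Pr => e e0.
move: r0; rewrite le_eqVlt => /predU1P[r0|r0].
  by have := key 1 ltr01 _ hPhi; rewrite -r0 mulr0 add0r => /le_trans; apply; exact: ltW.
have er : 1 < 1 + e / r by rewrite ltrDl divr_gt0.
have := key (ln (1 + e / r) / t); rewrite divr_gt0 ?ln_gt0 // => /(_ isT _ hPhi).
rewrite divfK ?gt_eqF // lnK; last by rewrite posrE (lt_trans _ er).
by rewrite mulrDl mul1r divfK ?gt_eqF.
Qed.

Lemma opexpt_uniform_bound : exists2 c : R, 0 < c &
  forall A (t : R) X, dissipative A -> 0 <= t -> norm1 (opexpt t A X) <= c * norm1 X.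
Proof.
have [c c0 hc] := @positive_tp_bound R d; exists c => // A t X dA t0.
by apply: gauge_le_norm1; apply: opexpt_gauge => // Phi hPhi; exact: hc.
Qed.

Let local_error_splitting (a b x y z : V) (h : C) :
  a - b = h *: (x - y) + ((a - z - h *: x) - (b - z - h *: y)).
Proof. by apply/matrixP => k l; rewrite !mxE; ring. Qed.

(** If [M G] and [A M] almost agree along the orbit of [W] under [G], then [M]
almost intertwines the two semigroups. In the Duhamel formula the derivative of
e^((t-s)A) M e^(sG) W in s is the residual transported by a contraction; the
proof sums the one-step errors instead of integrating. The
constant [c] depends neither on [A] nor on [G] and [M], which is what allows [A]
to blow up. *)
Lemma opexpt_intertwining_error : exists2 c : R, 0 < c &
  forall A (G M : {linear V -> V}) (W : V) (t dl : R), dissipative A -> 0 <= t ->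
  (forall s, 0 <= s <= t ->
     norm1 (M (G (opexpt s G W)) - A (M (opexpt s G W))) <= dl) ->
  norm1 (M (opexpt t G W) - opexpt t A (M W)) <= c * t * dl.
Proof.
have [c c0 hc] := @positive_tp_bound R d; exists c => // A G M W t dl dA.
rewrite le_eqVlt => /predU1P[<- _|t0 hdl].
  by rewrite !opexpt0 subrr norm1_0 mulr0 mul0r.
have [CG CG0 hCG] := opexpt_taylor2 G; have [CA CA0 hCA] := opexpt_taylor2 A.
have [CM CM0 hCM] := norm1_linear_bound M.
have [CE CE0 hCE] := opexpt_bound G (ltW t0).
pose Q := (CM * CG + CA * CM) * (CE * norm1 W).
have Q0 : 0 <= Q by rewrite !mulr_ge0 ?addr_ge0 ?norm1_ge0 ?mulr_ge0 // ltW.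
(* One-step error: first order [h * dl], plus the two Taylor remainders. *)
have loc s h : 0 <= s -> 0 <= h <= 1 -> s + h <= t ->
    norm1 (M (opexpt (h + s) G W) - opexpt h A (M (opexpt s G W))) <= h * dl + Q * h ^+ 2.
  move=> s0 /andP[h0 h1] sht.
  have st : 0 <= s <= t by rewrite s0 (le_trans _ sht) // lerDl.
  rewrite opexptD //; set Y := opexpt s G W.
  have nY : norm1 Y <= CE * norm1 W by exact: hCE.
  rewrite (local_error_splitting _ _ (M (G Y)) (A (M Y)) (M Y) h%:C).
  rewrite -(linearB M) -(linear_scale M) -(linearB M).
  rewrite (le_trans (norm1D _ _)) // lerD //.
    by rewrite norm1Zr ger0_norm // ler_wpM2l // hdl.
  have h01 : 0 <= h <= 1 by rewrite h0 h1.
  rewrite (le_trans (norm1B _ _)) // /Q -mulrA mulrDl lerD //.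
    rewrite (le_trans (hCM _)) // -mulrA ler_wpM2l ?(ltW CM0) //.
    rewrite (le_trans (hCG _ _ h01)) // -mulrA ler_wpM2l ?(ltW CG0) // mulrC.
    by rewrite ler_wpM2r ?sqr_ge0.
  rewrite (le_trans (hCA _ _ h01)) //.
  have H : norm1 (M Y) <= CM * (CE * norm1 W).
    by rewrite (le_trans (hCM Y)) // ler_wpM2l ?(ltW CM0).
  rewrite (le_trans (ler_wpM2l (mulr_ge0 (ltW CA0) (sqr_ge0 h)) H)) //.
  by rewrite le_eqVlt; apply/orP; left; apply/eqP; ring.
have glob (n : nat) : t <= n.+1%:R ->
    norm1 (M (opexpt t G W) - opexpt t A (M W)) <= c * t * dl + c * Q * t ^+ 2 / n.+1%:R.
  move=> tn; pose h := t / n.+1%:R.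
  have n0 : 0 < n.+1%:R :> R by rewrite ltr0n.
  have h0 : 0 < h by rewrite divr_gt0.
  have h1 : h <= 1 by rewrite ler_pdivrMr // mul1r.
  have nh : n.+1%:R * h = t by rewrite mulrC divfK // gt_eqF.
  have ind m : (m <= n.+1)%N ->
      gauge_le (M (opexpt (m%:R * h) G W) - opexpt (m%:R * h) A (M W))
        (m%:R * (c * (h * dl + Q * h ^+ 2))).
    elim: m => [|m IH] mn.
      by rewrite !mul0r !opexpt0 subrr => Phi _; rewrite linear0 norm1_0.
    have -> : m.+1%:R * h = h + m%:R * h by rewrite -nat1r mulrDl mul1r.
    rewrite -nat1r mulrDl mul1r [X in _ - X]opexptD ?(ltW h0) //.
    set E := opexpt (m%:R * h) A (M W); set Y := opexpt (m%:R * h) G W.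
    have -> : M (opexpt (h + m%:R * h) G W) - opexpt h A E
        = (M (opexpt (h + m%:R * h) G W) - opexpt h A (M Y))
          + opexpt h A (M Y - E).
      have -> : opexpt h A (M Y - E) = opexpt h A (M Y) - opexpt h A E by exact: linearB.
      exact: esym (subrKA _ _ _).
    apply: gauge_leD; last first.
      by apply: (opexpt_gauge dA (ltW h0)); apply: IH; exact: ltnW.
    move=> Phi hPhi; rewrite (le_trans (hc _ _ hPhi)) // ler_wpM2l ?(ltW c0) //.
    apply: loc; [by rewrite mulr_ge0 ?(ltW h0)|by rewrite (ltW h0) h1|].
    have -> : m%:R * h + h = m.+1%:R * h by rewrite -natr1 mulrDl mul1r.
    by rewrite -[leRHS]nh ler_pM2r // ler_nat.
  have := gauge_le_norm1 (ind n.+1 (leqnn _)); rewrite nh => /le_trans; apply.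
  by rewrite le_eqVlt; apply/orP; left; apply/eqP; rewrite /h; field; rewrite gt_eqF.
apply/ler_addgt0Pr => e e0.
(* Steps shorter than 1, and numerous enough for the accumulated second-order
   error to be below [e]. *)
pose n := Num.truncn (t + c * Q * t ^+ 2 / e).
have x0 : 0 <= c * Q * t ^+ 2 by apply: mulr_ge0 (sqr_ge0 t); apply: mulr_ge0 (ltW c0) Q0.
have xe0 : 0 <= c * Q * t ^+ 2 / e by apply: divr_ge0 x0 (ltW e0).
have nS : t + c * Q * t ^+ 2 / e < n.+1%:R by rewrite truncnS_gt.
rewrite (le_trans (glob n _)) //; first by rewrite ltW // (le_lt_trans _ nS) // lerDl.
rewrite lerD2l ler_pdivrMr ?ltr0n // [leRHS]mulrC -ler_pdivrMr // ltW //.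
by rewrite (le_lt_trans _ nS) // lerDr ltW.
Qed.

End contraction.

(** * Spectral decay of bounded semigroups *)

Section decay.
Context {R : realType}.
Implicit Types (p q v w : R -> R).

Definition decays p : Prop := exists e c : R,
  [/\ 0 < e, 0 <= c & forall t, 0 <= t -> `|p t| <= c * expR (- e * t)].

Lemma decays_pair p q : decays p -> decays q -> exists e c : R,
  [/\ 0 < e, 0 <= c & forall t, 0 <= t ->
     `|p t| <= c * expR (- e * t) /\ `|q t| <= c * expR (- e * t)].
Proof.
move=> [e [c [e0 c0 hp]]] [e' [c' [e'0 c'0 hq]]].
exists (Num.min e e'), (c + c'); split; [by rewrite lt_min e0|exact: addr_ge0|].
move=> t t0; split.
  apply: (le_trans (hp t t0)); apply: ler_pM; rewrite ?expR_ge0 ?lerDl //.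
  by rewrite ler_expR ler_wpM2r // lerN2 ge_min lexx.
apply: (le_trans (hq t t0)); apply: ler_pM; rewrite ?expR_ge0 ?lerDr //.
by rewrite ler_expR ler_wpM2r // lerN2 ge_min lexx orbT.
Qed.

Lemma decays_cvg0 p : decays p -> p t @[t --> +oo] --> 0.
Proof.
move=> [e [c [e0 c0 hp]]].
apply: norm_cvg0.
apply: (squeeze_cvgr (f := cst 0) (h := fun t => c * expR (- (e * t)))).
- near=> t; rewrite normr_ge0 /= -mulNr hp //.
- exact: cvg_cst.
- rewrite -[X in _ --> X](mulr0 c); apply: cvgMl_tmp.
  apply: (@cvg_comp _ _ _ (fun t => e * t) (fun t => expR (- t)) _ +oo); last exact: cvgr_expR.
  exact: gt0_cvgMry.
Unshelve. all: by end_near. Qed.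

(** With [p] and [q] the real and imaginary parts of a solution of
[u' = (x + i y) u + f], the energy [p ^+ 2 + q ^+ 2] does not see the rotation
[y], and half of the damping rate absorbs the forcing. *)
Lemma damped_pair_decays p q v w (x y : R) : x < 0 ->
  (forall t : R, is_derive t 1 p (x * p t - y * q t + v t)) ->
  (forall t : R, is_derive t 1 q (x * q t + y * p t + w t)) ->
  decays v -> decays w -> decays p /\ decays q.
Proof.
move=> x0 dp dq dv dw; have [e [c [e0 c0 hvw]]] := decays_pair dv dw.
(* Once the forcing is absorbed the energy is still damped at the rate [- x]; it is
   to decay at the rate [2 * e'], which has to be strictly smaller. *)
pose e' := Num.min e (- x / 4).
have e'0 : 0 < e' by rewrite lt_min e0 divr_gt0 // oppr_gt0.
pose b := - (2 * e').
have e'x : e' <= - x / 4 by rewrite ge_min lexx orbT.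
have xb : x < b by rewrite /b; lra.
pose g : R -> R := p * p + q * q.
pose g' t := 2 * x * g t + 2 * (p t * v t + q t * w t).
have dg (t : R) : is_derive t 1 g (g' t).
  have d1 := dp t; have d2 := dq t.
  apply: (is_derive_eq (is_deriveD (is_deriveM d1 d1) (is_deriveM d2 d2))).
  have sE (r s : R) : r *: s = r * s by [].
  by rewrite !sE /g' /g; rewrite !fctE; ring.
pose cc := 2 * c ^+ 2 / - x.
have cc0 : 0 <= cc by rewrite divr_ge0 ?mulr_ge0 ?sqr_ge0 // oppr_ge0 ltW.
have hg (t : R) : 0 <= t -> g' t <= x * g t + cc * expR (b * t).
  move=> t0; have [hv hw] := hvw t t0.
  have eb : expR (- e * t) ^+ 2 <= expR (b * t).
    rewrite -expRM_natl ler_expR /b.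
    have : e' * t <= e * t by rewrite ler_wpM2r // ge_min lexx.
    by rewrite -[2%:R]/(2 : R); nra.
  have sq u : `|u| <= c * expR (- e * t) -> u ^+ 2 <= c ^+ 2 * expR (b * t).
    move=> hu; rewrite -real_normK ?num_real //.
    apply: (@le_trans _ _ ((c * expR (- e * t)) ^+ 2)).
      by rewrite lerXn2r ?nnegrE // mulr_ge0 ?expR_ge0.
    by rewrite exprMn ler_wpM2l ?sqr_ge0.
  have := sq _ hv; have := sq _ hw.
  set E := expR (b * t); set a := - x => hw2 hv2.
  have a0 : 0 < a by rewrite oppr_gt0.
  (* Young's inequality with weight [a = - x]. *)
  have young r s : 2 * (r * s) <= a * r ^+ 2 + s ^+ 2 / a.
    have : 0 <= (a * r - s) ^+ 2 / a by rewrite divr_ge0 ?sqr_ge0 // ltW.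
    have -> : (a * r - s) ^+ 2 / a = a * r ^+ 2 - 2 * (r * s) + s ^+ 2 / a.
      by field; rewrite gt_eqF.
    lra.
  have y1 := young (p t) (v t); have y2 := young (q t) (w t).
  have z1 : v t ^+ 2 / a <= c ^+ 2 * E / a by rewrite ler_wpM2r // invr_ge0 ltW.
  have z2 : w t ^+ 2 / a <= c ^+ 2 * E / a by rewrite ler_wpM2r // invr_ge0 ltW.
  have -> : cc * E = c ^+ 2 * E / a + c ^+ 2 * E / a by rewrite /cc -/a; field; rewrite gt_eqF.
  have xa : x = - a by rewrite opprK.
  have gE : g t = p t ^+ 2 + q t ^+ 2 by rewrite /g !fctE !expr2.
  rewrite /g' gE xa; lra.
have := gronwall xb cc0 dg hg.
set D := g 0 + cc / (b - x) => hgr.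
have g00 : 0 <= g 0 by rewrite /g !fctE -!expr2 addr_ge0 ?sqr_ge0.
have cb0 : 0 <= cc / (b - x) by rewrite divr_ge0 // subr_ge0 ltW.
have hD t : 0 <= t -> g t <= D * expR (b * t).
  move=> t0; apply: (le_trans (hgr t t0)); rewrite /D [leRHS]mulrDl lerD2r ler_wpM2l //.
  by rewrite ler_expR ler_wpM2r // ltW.
have D0 : 0 <= D by exact: addr_ge0.
have fin r : (forall t, r t ^+ 2 <= g t) -> decays r.
  move=> hr; exists e', (Num.sqrt D); split; [by []|exact: sqrtr_ge0|move=> t t0].
  have := le_trans (hr t) (hD t t0).
  rewrite -ler_sqrt; last by rewrite mulr_ge0 ?expR_ge0.
  rewrite sqrtr_sqr => /le_trans; apply.
  rewrite sqrtrM // ler_wpM2l ?sqrtr_ge0 //.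
  rewrite (_ : b * t = 2%:R * (- e' * t)); last by rewrite /b; ring.
  by rewrite expRM_natl sqrtr_sqr ger0_norm ?expR_ge0.
by split; apply: fin => t; rewrite /g !fctE -!expr2 ?lerDl ?lerDr sqr_ge0.
Qed.

End decay.

Section spectral.
Context {R : realType} {d : nat}.
Local Notation C := R[i].
Local Notation V := 'M[C]_d.
Implicit Types (A : {linear V -> V}) (X Y : V) (zs : seq C).

Lemma rcoord_re_scale p (z : C) X : rcoord (true, p) (z *: X) =
  complex.Re z * rcoord (true, p) X - complex.Im z * rcoord (false, p) X.
Proof. by rewrite /rcoord mxE; exact: complex_ReM. Qed.

Lemma rcoord_im_scale p (z : C) X : rcoord (false, p) (z *: X) =
  complex.Re z * rcoord (false, p) X + complex.Im z * rcoord (true, p) X.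
Proof. by rewrite /rcoord mxE; exact: complex_ImM. Qed.

Definition orbit_decays A X := forall k, decays (fun t => rcoord k (opexpt t A X)).

(** The orbit u of [X] satisfies u' = z u + f, where f is the orbit of
[A X - z *: X]. *)
Lemma orbit_decays_step A z X : complex.Re z < 0 ->
  orbit_decays A (A X - z *: X) -> orbit_decays A X.
Proof.
move=> z0 hd; suff h p : decays (fun t => rcoord (true, p) (opexpt t A X)) /\
    decays (fun t => rcoord (false, p) (opexpt t A X)) by move=> [[] p]; case: (h p).
have split_t t : opexpt t A (A X) = z *: opexpt t A X + opexpt t A (A X - z *: X).
  by rewrite (linearB (opexpt t A)) (linear_scale (opexpt t A)) addrC subrK.
apply: (damped_pair_decays (y := complex.Im z) z0 _ _ (hd (true, p)) (hd (false, p))) => t.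
  by rewrite -rcoord_re_scale -rcoordD -split_t; exact: opexpt_deriv.
by rewrite -rcoord_im_scale -rcoordD -split_t; exact: opexpt_deriv.
Qed.

(** Otherwise the orbit of the eigenvector would grow exponentially, at rate Re z,
against the uniform bound. *)
Lemma dissipative_eigenvalue_Re A z X :
  dissipative A -> X != 0 -> A X = z *: X -> complex.Re z <= 0.
Proof.
move=> dA X0 AX; rewrite leNgt; apply/negP => z0.
have [c c0 hc] := @opexpt_uniform_bound R d.
move/eqP: X0; apply; apply: rcoord_inj => -[b p]; rewrite rcoord0.
pose u b t := rcoord (b, p) (opexpt t A X).
suff : u true 0 ^+ 2 + u false 0 ^+ 2 <= 0.
  rewrite /u opexpt0; have := sqr_ge0 (rcoord (true, p) X); have := sqr_ge0 (rcoord (false, p) X).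
  by move=> h1 h2 h; apply/eqP; rewrite -sqrf_eq0; apply/eqP; case: b; lra.
move g0E : (u true 0 ^+ 2 + u false 0 ^+ 2) => g0.
pose g : R -> R := - (u true * u true + u false * u false).
have dg (t : R) : is_derive t 1 g (2 * complex.Re z * g t).
  have d1 : is_derive t 1 (u true) (complex.Re z * u true t - complex.Im z * u false t).
    by rewrite /u -rcoord_re_scale -(linear_scale (opexpt t A)) -AX; exact: opexpt_deriv.
  have d2 : is_derive t 1 (u false) (complex.Re z * u false t + complex.Im z * u true t).
    by rewrite /u -rcoord_im_scale -(linear_scale (opexpt t A)) -AX; exact: opexpt_deriv.
  apply: (is_derive_eq (is_deriveN (is_deriveD (is_deriveM d1 d1) (is_deriveM d2 d2)))).
  have sE (r s : R) : r *: s = r * s by [].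
  by rewrite !sE /g !fctE; ring.
have hg (t : R) : 0 <= t -> 2 * complex.Re z * g t
    <= 2 * complex.Re z * g t + 0 * expR ((2 * complex.Re z + 1) * t).
  by rewrite mul0r addr0.
have ab : 2 * complex.Re z < 2 * complex.Re z + 1 by rewrite ltrDl.
have := gronwall ab (lexx 0) dg hg => hgr.
rewrite leNgt; apply/negP => g00.
(* The uniform bound on the energy of the two coordinates. *)
pose M := 2 * (c * norm1 X) ^+ 2.
have M0 : 0 <= M by rewrite mulr_ge0 ?sqr_ge0.
(* At this time [1 + 2 t Re z], a lower bound of the growth factor, already exceeds
   the ratio between the bound [M] and the initial energy [g0]. *)
pose t := M / g0 / (2 * complex.Re z).
have t0 : 0 <= t.
  by apply: divr_ge0; [exact: divr_ge0 M0 (ltW g00)|exact: mulr_ge0 (ltW z0)].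
have := hgr t t0; rewrite mul0r mul0r addr0.
have -> : g 0 = - g0 by rewrite -g0E /g !fctE !expr2.
have hu b' : u b' t ^+ 2 <= (c * norm1 X) ^+ 2.
  rewrite -real_normK ?num_real // lerXn2r ?nnegrE ?mulr_ge0 ?norm1_ge0 ?(ltW c0) //.
  by rewrite (le_trans (rcoord_le_norm1 _ _)) // hc.
have -> : 2 * complex.Re z * t = M / g0.
  by rewrite mulrC divfK // gt_eqF // mulr_gt0.
rewrite /g !fctE mulNr lerN2 => H.
have := ler_wpM2l (ltW g00) (expR_ge1Dx (M / g0)).
have -> : g0 * (1 + M / g0) = g0 + M by field; rewrite gt_eqF.
move=> /le_trans/(_ H); move: (hu true) (hu false) g00; rewrite /M !expr2.
by move: (u true t * u true t) (u false t * u false t) => x y; clear; lra.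
Qed.

(** The orbit of [X] is affine in time, with slope [A X], and a bounded affine
function is constant. *)
Lemma dissipative_ker2 A X : dissipative A -> A (A X) = 0 -> A X = 0.
Proof.
move=> dA AAX; apply/norm1_eq0/eqP; rewrite eq_le norm1_ge0 andbT leNgt; apply/negP => n0.
have [c c0 hc] := @opexpt_uniform_bound R d.
pose t := (c * norm1 X + norm1 X + 1) / norm1 (A X).
have t0 : 0 <= t.
  by rewrite divr_ge0 ?addr_ge0 ?mulr_ge0 ?norm1_ge0 // ltW.
have := hc A t X dA t0; rewrite opexpt_affine //.
have : norm1 (t%:C *: A X) <= norm1 (X + t%:C *: A X) + norm1 X.
  by rewrite -{1}[t%:C *: A X](addKr X) addrC (le_trans (norm1B _ _)).
rewrite norm1Zr ger0_norm // divfK ?gt_eqF //.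
lra.
Qed.

(** The product of the operators [A - z] for [z] in [zs], that is the value at [A] of
the polynomial with roots [zs]. *)
Definition shifted A zs X := foldl (fun Y z => A Y - z *: Y) X zs.

Fact shifted_is_linear A zs : linear (shifted A zs).
Proof.
move=> a X Y; elim: zs X Y => //= z zs IH X Y.
rewrite -IH; congr shifted; rewrite linearP; apply/matrixP => i j; rewrite !mxE; ring.
Qed.

HB.instance Definition _ A zs :=
  GRing.isLinear.Build C V V *:%R (shifted A zs) (shifted_is_linear A zs).

Lemma shifted_comm A zs X : shifted A zs (A X) = A (shifted A zs X).
Proof.
elim: zs X => //= z zs IH X; rewrite -IH; congr shifted.
by rewrite (linearB A) (linear_scale A).
Qed.

Lemma shifted_decays A zs X : (forall z, z \in zs -> complex.Re z < 0) ->
  shifted A zs X = 0 -> orbit_decays A X.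
Proof.
elim: zs X => [|z zs IH] X hz /=.
  move=> -> k; exists 1, 0; split=> // t t0.
  by rewrite linear0 rcoord0 normr0 mul0r.
move=> hX; apply: (@orbit_decays_step A z); first by rewrite hz ?mem_head.
by apply: IH => // y yzs; rewrite hz // inE yzs orbT.
Qed.

(** A polynomial that does not vanish at 0 is its nonzero constant term plus a
multiple of the variable. *)
Lemma shifted_bezout A zs : 0 \notin zs -> exists2 a : C, a != 0 &
  forall X, exists Y, shifted A zs X = a *: X + A Y.
Proof.
elim: zs => [|z zs IH]; first by exists 1 => [|X]; rewrite ?oner_eq0 //;
  exists 0; rewrite linear0 addr0 scale1r.
rewrite inE negb_or eq_sym => /andP[z0 /IH[a a0 ha]].
exists (- (a * z)); first by rewrite oppr_eq0 mulf_neq0.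
move=> X; have [Y /= ->] := ha (A X - z *: X); exists (a *: X + Y).
by rewrite linearP; apply/matrixP => i j; rewrite !mxE; ring.
Qed.

Lemma shifted_zeros A m X : shifted A (nseq m 0) X = iter m A X.
Proof. by elim: m X => //= m IH X; rewrite IH scale0r subr0 -iterSr. Qed.

(** Cayley-Hamilton, with the characteristic polynomial split into linear factors. The roots may be
taken in any order because the factors commute as polynomials. *)
Lemma mx_annihilated (n : nat) (M : 'M[C]_n.+1) : exists2 rs : seq C,
  (forall r, r \in rs -> eigenvalue M r) &
  forall rs' (v : 'rV_n.+1), perm_eq rs rs' ->
    foldl (fun w r => w *m M - r *: w) v rs' = 0.
Proof.
have [rs rsE] := closed_field_poly_normal (char_poly M).
have chi1 : lead_coef (char_poly M) = 1 by apply/monicP; exact: char_poly_monic.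
rewrite chi1 scale1r in rsE.
exists rs => [r rrs|rs' v prs].
  by rewrite eigenvalue_root_char rsE root_prod_XsubC.
have -> : foldl (fun w r => w *m M - r *: w) v rs'
    = v *m horner_mx M (\prod_(r <- rs') ('X - r%:P)).
  elim: rs' v {prs} => [|r s IH] v /=; first by rewrite big_nil rmorph1 mulmx1.
  rewrite IH big_cons rmorphM /= mulmxA; congr (_ *m _).
  by rewrite rmorphB /= horner_mx_X horner_mx_C mulmxBr mul_mx_scalar.
by rewrite -(perm_big _ prs) /= -rsE Cayley_Hamilton mulmx0.
Qed.

Let castK m n (e : m = n) (w : 'rV[C]_m) :
  castmx (erefl, esym e) (castmx (erefl, e) w) = w.
Proof. by case: _ / e; rewrite !castmx_id. Qed.

Let castVK m n (e : m = n) (w : 'rV[C]_n) :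
  castmx (erefl, e) (castmx (erefl, esym e) w) = w.
Proof. by case: _ / e w => w; rewrite !castmx_id. Qed.

Let cast_linear m n (e : m = n) (a : C) (w w' : 'rV[C]_m) :
  castmx (erefl, e) (a *: w + w') = a *: castmx (erefl, e) w + castmx (erefl, e) w'.
Proof. by case: _ / e; rewrite !castmx_id. Qed.

Lemma shifted_annihilated A : exists2 rs : seq C,
  (forall r, r \in rs -> exists2 X, X != 0 & A X = r *: X) &
  forall rs' X, perm_eq rs rs' -> shifted A rs' X = 0.
Proof.
have [d0|d_gt0] := posnP d.
  exists [::] => // rs' X _; apply/matrixP => i.
  by exfalso; case: (i) => m; rewrite d0.
(* Evaluating a polynomial at a matrix needs a size of the form [n.+1]. *)
have [n nE] : exists n, (d * d)%N = n.+1.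
  by exists (d * d).-1; rewrite prednK // muln_gt0 d_gt0.
pose M := castmx (nE, nE) (lin_mx A).
pose vec X := castmx (erefl, nE) (mxvec X).
have vecM X : vec X *m M = vec (A X).
  rewrite /vec /M -mul_vec_lin; move: (lin_mx A) (mxvec X).
  have castM m (e : (d * d)%N = m) (w : 'rV[C]_(d * d)) (B : 'M[C]_(d * d)) :
      castmx (erefl, e) w *m castmx (e, e) B = castmx (erefl, e) (w *m B).
    by case: _ / e; rewrite !castmx_id.
  by move=> B w; rewrite castM.
have vec_inj : injective vec.
  move=> X Y /(congr1 (castmx (erefl, esym nE))).
  by rewrite !castK => /(can_inj mxvecK).
have vecP a U W : vec (a *: U + W) = a *: vec U + vec W.
  by rewrite /vec linearP cast_linear.
have vec0 : vec 0 = 0.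
  by rewrite /vec linear0; apply/matrixP => i j; rewrite castmxE !mxE.
have [rs hrs ann] := mx_annihilated M.
exists rs => [r /hrs /eigenvalueP[w wM w0]|rs' X prs].
  pose Y := vec_mx (castmx (erefl, esym nE) w).
  have YE : vec Y = w by rewrite /vec /Y vec_mxK castVK.
  exists Y.
    by apply: contra_neq w0 => Y0; rewrite -YE Y0 vec0.
  by apply: vec_inj; rewrite -vecM YE wM -[r *: Y]addr0 vecP vec0 addr0 YE.
apply: vec_inj; have := ann rs' (vec X) prs.
rewrite vec0 => <-; elim: rs' {prs} X => //= r s IH X; rewrite IH; congr foldl.
by rewrite vecM addrC -scaleNr vecP scaleNr addrC.
Qed.

(** Let [zs] be the nonzero roots of the characteristic polynomial. They have
negative real part, and [q(A) = shifted A zs] maps into the generalized kernel of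
[A], hence into its kernel. Dividing by the constant term of [q] yields the
projection onto the kernel; its complement is in the range of [A] and is killed
by [q(A)], so its orbits decay. *)
Lemma spectral_splitting A : dissipative A ->
  (forall z X, X != 0 -> A X = z *: X -> complex.Re z = 0 -> z = 0) ->
  forall X, exists X0 Y, [/\ A X0 = 0, X = X0 + A Y & orbit_decays A (A Y)].
Proof.
move=> dA hspec X; have [rs eig ann] := shifted_annihilated A.
pose zs := [seq r <- rs | r != 0].
have z0 : 0 \notin zs by rewrite mem_filter eqxx.
have Rez z : z \in zs -> complex.Re z < 0.
  rewrite mem_filter => /andP[zn0 /eig[Y Y0 AY]].
  rewrite lt_neqAle (dissipative_eigenvalue_Re dA Y0 AY) andbT.
  by apply: contra_neq zn0; exact: hspec Y0 AY.
(* Sort the roots so that the factor belonging to the eigenvalue 0 comes last. *)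
pose m := count (predC [pred r | r != 0]) rs.
have prs : perm_eq rs (zs ++ nseq m 0).
  rewrite -(perm_filterC [pred r | r != 0]) perm_cat2l /m -size_filter perm_sym.
  suff /all_pred1P <- : all (pred1 0) [seq x <- rs | predC [pred r | r != 0] x] by [].
  by apply/allP => y; rewrite mem_filter /= negbK => /andP[].
have key Y : A (shifted A zs Y) = 0.
  have : iter m A (shifted A zs Y) = 0.
    by rewrite -shifted_zeros -[RHS](ann _ Y prs) /shifted foldl_cat.
  elim: m {prs} => [|m IH] /=; first by move=> ->; rewrite linear0.
  case: m IH => [|m] IH //= h; apply: IH; exact: dissipative_ker2.
have [a a0 ha] := shifted_bezout A z0.
have [Y hY] := ha X.
exists (a^-1 *: shifted A zs X), (- (a^-1 *: Y)); split.
- by rewrite (linear_scale A) key scaler0.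
- rewrite hY (linearN A) (linear_scale A) scalerDr scalerA mulVf // scale1r.
  by rewrite addrK.
- by apply: (shifted_decays Rez); rewrite shifted_comm key.
Qed.

End spectral.

(** * The asymptotic projector and the pseudo-inverse *)

Section half_line_integral.
Context {R : realType}.

(** Adding the integrable majorant [c * expR (- e * t)] makes the integrand
nonnegative, so that monotone convergence gives the fundamental theorem on the
half-line; the integral of the majorant is then subtracted. *)
Lemma integral_decaying_derivative (f F : R -> R) (l : R) :
  (forall t : R, is_derive t 1 F (f t)) -> continuous f -> decays f ->
  F t @[t --> +oo] --> l ->
  \int[lebesgue_measure]_(t in `[0, +oo[) f t = l - F 0.
Proof.
move=> dF cf [e [c [e0 c0 hf]]] Fl.
pose E (t : R) := c * expR (- e * t).
pose G (t : R) := - (c / e) * expR (- e * t).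
have dG (t : R) : is_derive t 1 G (E t).
  have d1 := is_derive_expRM (- e) t.
  rewrite (_ : G = (- (c / e)) \*: (fun s => expR (- e * s))) //.
  apply: is_derive_eq.
  have sE (r s : R) : r *: s = r * s by [].
  by rewrite sE /E; field; rewrite gt_eqF.
have cexp : continuous (fun t : R => expR (- e * t)).
  move=> t; apply: differentiable_continuous; apply/derivable1_diffP.
  have d1 := is_derive_expRM (- e) t; exact: ex_derive.
have cE : continuous E by move=> t; apply: cvgMl_tmp; exact: cexp.
have E0 t : 0 <= E t by rewrite mulr_ge0 ?expR_ge0.
have Ginf : G t @[t --> +oo] --> 0.
  rewrite -[X in _ --> X](mulr0 (- (c / e))); apply: cvgMl_tmp.
  under eq_fun do rewrite mulNr.
  apply: (@cvg_comp _ _ _ (fun t => e * t) (fun t => expR (- t)) _ +oo); last exact: cvgr_expR.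
  exact: gt0_cvgMry.
have cont_of (h h' : R -> R) (t : R) : is_derive t 1 h (h' t) -> {for t, continuous h}.
  move=> dh; apply: differentiable_continuous; apply/derivable1_diffP; exact: ex_derive.
have ftc (h h' : R -> R) m : (forall t, 0 <= t -> 0 <= h' t) -> continuous h' ->
    h t @[t --> +oo] --> m -> (forall t : R, is_derive t 1 h (h' t)) ->
    (\int[lebesgue_measure]_(t in `[0%R, +oo[) (h' t)%:E = m%:E - (h 0)%:E)%E.
  move=> h0 ch hm dh; apply: ge0_continuous_FTC2y => //.
  - exact: continuous_subspaceT.
  - by apply: cvg_at_right_filter; exact: cont_of (dh 0).
  - by move=> t _; have dht := dh t; rewrite derive1E derive_val.
have mE : measurable_fun (`[0%R, +oo[ : set R) E.
  by apply: measurable_funTS; exact: continuous_measurable_fun.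
have mf : measurable_fun (`[0%R, +oo[ : set R) f.
  by apply: measurable_funTS; exact: continuous_measurable_fun.
have iE : lebesgue_measure.-integrable (`[0%R, +oo[ : set R) (EFin \o E).
  apply/integrableP; split; first exact/measurable_EFinP.
  under eq_integral do rewrite /= ger0_norm //.
  by rewrite (ftc G E 0) // -EFinB ltry.
have if_ : lebesgue_measure.-integrable (`[0%R, +oo[ : set R) (EFin \o f).
  apply: (le_integrable _ _ _ iE) => //; first exact/measurable_EFinP.
  move=> t; rewrite /= in_itv /= andbT => t0.
  by rewrite lee_fin (le_trans (hf _ t0)) // ler_norm.
have iEr : \int[lebesgue_measure]_(t in `[0, +oo[) E t = 0 - G 0.
  by rewrite /Rintegral (ftc G E 0) // -EFinB.
have fE0 (t : R) : 0 <= t -> 0 <= f t + E t.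
  move=> t0; have := hf t t0; rewrite ler_norml => /andP[h1 _].
  by rewrite -lerBlDr sub0r.
have cfE : continuous (fun t => f t + E t).
  by move=> t; apply: cvgD; [exact: cf|exact: cE].
have FGl : F t + G t @[t --> +oo] --> l + 0 by exact: cvgD.
have dFG (t : R) : is_derive t 1 (fun t => F t + G t) (f t + E t).
  have d1 := dF t; have d2 := dG t; exact: is_deriveD.
have : \int[lebesgue_measure]_(t in `[0, +oo[) (f t + E t) = l + 0 - (F 0 + G 0).
  by rewrite /Rintegral (ftc _ _ _ fE0 cfE FGl dFG) -EFinB.
by rewrite RintegralD // iEr => /(canRL (addrK _)) ->; ring.
Qed.

End half_line_integral.

Section projector.
Context {R : realType} {d : nat}.
Local Notation C := R[i].
Local Notation V := 'M[C]_d.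
Variable A : {linear V -> V}.
Hypothesis dA : dissipative A.
Hypothesis hspec : forall z X, X != 0 -> A X = z *: X -> complex.Re z = 0 -> z = 0.
Local Notation P := (asymptotic_proj A).

Lemma asymptotic_proj_splitting X :
  [/\ opexpt t A X @[t --> +oo] --> P X, A (P X) = 0 &
    exists Y, X = P X + A Y /\ orbit_decays A (A Y)].
Proof.
have [X0 [Y [AX0 XE hY]]] := spectral_splitting dA hspec X.
have cv : opexpt t A X @[t --> +oo] --> X0.
  apply/cvg_rcoordP => k; rewrite -[X in _ --> X]addr0.
  have : rcoord k X0 + rcoord k (opexpt t A (A Y)) @[t --> +oo] --> rcoord k X0 + 0.
    by apply: cvgD; [exact: cvg_cst|exact: decays_cvg0].
  apply: cvg_trans; apply: near_eq_cvg; near=> t.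
  have t0 : 0 <= t by near: t; exact: nbhs_pinfty_ge.
  by rewrite {1}XE linearD rcoordD /= (opexpt_cst t0 AX0).
have PX : P X = X0 by exact: cvg_norm1_lim.
by rewrite PX; split=> //; exists Y.
Unshelve. all: by end_near. Qed.

Lemma asymptotic_proj_cvg X : opexpt t A X @[t --> +oo] --> P X.
Proof. by have [] := asymptotic_proj_splitting X. Qed.

Arguments asymptotic_proj_cvg : clear implicits.

Lemma asymptotic_proj_is_linear : linear P.
Proof.
move=> a X Y; apply: cvg_norm1_lim.
pose proof (cvg_addm (cvg_linear (B := *:%R a) (asymptotic_proj_cvg X))
  (asymptotic_proj_cvg Y)) as h.
by rewrite (_ : (fun t => _) = (fun t => a *: opexpt t A X + opexpt t A Y)) //;
  apply/funext => t; rewrite linearP.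
Qed.

Lemma asymptotic_proj_ker X : A X = 0 -> P X = X.
Proof.
move=> AX; apply: cvg_norm1_lim.
have : X @[t --> (+oo : set_system R)] --> X by exact: cvg_cst.
apply: cvg_trans; apply: near_eq_cvg; near=> t.
have t0 : 0 <= t by near: t; exact: nbhs_pinfty_ge.
by rewrite opexpt_cst.
Unshelve. all: by end_near. Qed.

Lemma gen_asymptotic_proj X : A (P X) = 0.
Proof. by have [] := asymptotic_proj_splitting X. Qed.

Lemma asymptotic_proj_idem X : P (P X) = P X.
Proof. exact/asymptotic_proj_ker/gen_asymptotic_proj. Qed.

Lemma rcoord_mx_integral k (D : set R) (F : R -> V) :
  rcoord k (mx_integral D F) = \int[lebesgue_measure]_(s in D) rcoord k (F s).
Proof. by rewrite /rcoord !mxE; case: k.1. Qed.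

(** Along [X - P X = A Y] the integrand is the derivative of the orbit of [Y], which
runs from [Y] to [P Y]. *)
Lemma pseudo_inverse_gen X Y : X = P X + A Y -> orbit_decays A (A Y) ->
  pseudo_inverse A X = Y - P Y.
Proof.
move=> XE hY; apply: rcoord_inj => k.
have I : \int[lebesgue_measure]_(s in `[0, +oo[) rcoord k (opexpt s A (A Y))
    = rcoord k (P Y) - rcoord k (opexpt 0 A Y).
  apply: (@integral_decaying_derivative R (fun s => rcoord k (opexpt s A (A Y)))
    (fun s => rcoord k (opexpt s A Y))).
  - by move=> t; exact: opexpt_deriv.
  - move=> t; apply: differentiable_continuous; apply/derivable1_diffP.
    have d1 := opexpt_deriv A (A Y) k t; exact: ex_derive.
  - exact: hY.
  - exact: cvg_rcoord (asymptotic_proj_cvg Y).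
transitivity (- \int[lebesgue_measure]_(s in `[0, +oo[) rcoord k (opexpt s A (A Y))).
  rewrite /pseudo_inverse rcoordN; congr (- _).
  apply: (etrans (rcoord_mx_integral _ _ _)); apply: eq_Rintegral => s.
  rewrite inE /= in_itv /= andbT => s0.
  by rewrite {1}XE linearD /= opexpt_cst ?gen_asymptotic_proj // addrC addKr.
by rewrite I opexpt0 opprB -rcoordB.
Qed.

Lemma gen_pseudo_inverse X : A (pseudo_inverse A X) = X - P X.
Proof.
have [_ _ [Y [XE hY]]] := asymptotic_proj_splitting X.
rewrite (pseudo_inverse_gen XE hY) (linearB A) gen_asymptotic_proj subr0.
by rewrite {1}XE [RHS]addrC addKr.
Qed.

Lemma asymptotic_proj_pseudo_inverse X : P (pseudo_inverse A X) = 0.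
Proof.
have [_ _ [Y [XE hY]]] := asymptotic_proj_splitting X.
rewrite (pseudo_inverse_gen XE hY).
have [Pl PE] := linear_lift asymptotic_proj_is_linear.
by rewrite -!PE linearB /= !PE asymptotic_proj_idem subrr.
Qed.

(** [pseudo_inverse A X] is the only solution [Z] of [A Z = X - P X] and [P Z = 0],
and this system is linear in [X]. *)
Lemma pseudo_inverse_is_linear : linear (pseudo_inverse A).
Proof.
have [Pl PE] := linear_lift asymptotic_proj_is_linear.
move: (pseudo_inverse A) gen_pseudo_inverse asymptotic_proj_pseudo_inverse.
move=> S AS PS a X Y; apply/eqP; rewrite -subr_eq0; apply/eqP.
set W := _ - _.
have AW : A W = 0.
  have -> : A W = A (S (a *: X + Y)) - (a *: A (S X) + A (S Y)).
    by rewrite /W (linearB A) (linearP A).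
  rewrite !AS -!PE (linearP Pl); move: (Pl X) (Pl Y) => X' Y'.
  by apply/matrixP => i j; rewrite !mxE; ring.
suff PW : Pl W = 0 by rewrite -PW PE; apply/esym/asymptotic_proj_ker.
rewrite /W (linearB Pl) (linearP Pl) !PE !PS.
by rewrite scaler0 addr0 subr0.
Qed.

End projector.

(** * The strong-damping limit *)

Section strong_damping.
Context {R : realType} {d : nat}.
Local Notation C := R[i].
Local Notation V := 'M[C]_d.
Variables L0 L1 L2 P S : {linear V -> V}.
Hypotheses (dL0 : dissipative L0) (dL1 : dissipative L1) (dL2 : dissipative L2).
Hypothesis PP : forall X, P (P X) = P X.
Hypothesis L2P : forall X, L2 (P X) = 0.
Hypothesis L2S : forall X, L2 (S X) = X - P X.
Hypothesis P_cvg : forall X, opexpt t L2 X @[t --> +oo] --> P X.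
Hypothesis PL1P : forall X, P (L1 (P X)) = 0.

Lemma quadratic_family_linear (g : R) : exists A : {linear V -> V},
  A =1 quadratic_family L0 L1 L2 g.
Proof. by exists (L0 \+ g%:C \*: L1 \+ (g ^+ 2)%:C \*: L2). Qed.

Lemma quadratic_family_dissipative (g : R) : 0 < g ->
  dissipative (quadratic_family L0 L1 L2 g).
Proof.
move=> g0; apply: dissipativeD; first apply: dissipativeD => //.
  exact: dissipativeZ.
by apply: dissipativeZ => //; exact: exprn_gt0.
Qed.

Let Q : {linear V -> V} := L0 \- (L1 \o S \o L1).

Let QE X : Q X = L0 X - L1 (S (L1 X)). Proof. by []. Qed.

(** Order by order in [g]: [L2 P = 0] kills [g ^+ 2], [L2 S = 1 - P] and
[P L1 P = 0] kill [g], and the last corrector [S Q P] absorbs the component of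
[Q P] outside the range of [P], leaving [P Q P] at order 0. *)
Lemma corrector_residual (A M G : {linear V -> V}) (g : R) (U : V) : 0 < g ->
  A =1 quadratic_family L0 L1 L2 g ->
  (forall X, G X = P (Q (P X))) ->
  (forall X, M X = P X - g^-1%:C *: S (L1 (P X)) - (g^-1 ^+ 2)%:C *: S (Q (P X))) ->
  M (G U) - A (M U) =
    g^-1%:C *: (L0 (S (L1 (P U))) + L1 (S (Q (P U))) - S (L1 (P (Q (P U)))))
    + (g^-1 ^+ 2)%:C *: (L0 (S (Q (P U))) - S (Q (P (Q (P U))))).
Proof.
move=> g0 AE GE ME; rewrite !ME !GE !PP AE /quadratic_family.
have lin3 (B : {linear V -> V}) (a b : C) X Y Z :
    B (X - a *: Y - b *: Z) = B X - a *: B Y - b *: B Z.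
  by rewrite (linearB B) (linearB B) !(linear_scale B).
rewrite !lin3 L2P !L2S PL1P.
have -> : L0 (P U) = Q (P U) + L1 (S (L1 (P U))) by rewrite QE subrK.
move: (Q (P U)) => q; move: (S (L1 (P U))) (L1 (P U)) (P q) => s b p.
move: (L0 s) (L1 s) (L0 (S q)) (L1 (S q)) (S q) (S (L1 p)) (S (Q p))
  => s0 s1 w0 w1 w x y.
have gn0 : g%:C != 0 :> C.
  by rewrite -(rmorph0 (real_complex R)) (inj_eq (@complexI R)) gt_eqF.
rewrite !rmorphXn !fmorphV /=; move: (g%:C) gn0 => z z0.
by apply/matrixP => i j; rewrite !mxE; field.
Qed.

Let telescope3 (x y z w : V) : x - w = (x - y) - (z - y) - (w - z).
Proof. by apply/matrixP => i j; rewrite !mxE; ring. Qed.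

Let split_proj (x y z : V) : x - z = (y - z) + (x - y).
Proof. by rewrite [RHS]addrC subrKA. Qed.

Let norm1_triangle (x y : V) : norm1 y <= norm1 (x - y) + norm1 x.
Proof. by rewrite -{1}[y](subKr x) [leRHS]addrC norm1B. Qed.

(** Compare both sides with M e^(tG) P X, where [M] is the corrected projector:
the intertwining error and the two occurrences of [M - P] are all [O(1/g)]. *)
Lemma slow_modes_limit (G : {linear V -> V}) (t : R) X : 0 <= t ->
  (forall X, G X = P (Q (P X))) ->
  exists2 D : R, 0 <= D & forall g, 1 <= g ->
    norm1 (opexpt t (quadratic_family L0 L1 L2 g) (P X) - P (opexpt t G (P X)))
      <= D / g.
Proof.
move=> t0 GE.
have [c c0 hc] := @opexpt_uniform_bound R d.
have [c' c'0 hc'] := @opexpt_intertwining_error R d.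
have [CE CE0 hCE] := opexpt_bound G t0.
pose B := CE * norm1 (P X).
have B0 : 0 <= B by rewrite mulr_ge0 ?norm1_ge0 // ltW.
have [K1 K10 hK1] := norm1_linear_bound
  ((L0 \o S \o L1 \o P) \+ (L1 \o S \o Q \o P) \- (S \o L1 \o P \o Q \o P)).
have [K2 K20 hK2] := norm1_linear_bound
  ((L0 \o S \o Q \o P) \- (S \o Q \o P \o Q \o P)).
have [K3 K30 hK3] := norm1_linear_bound (S \o L1 \o P).
have [K4 K40 hK4] := norm1_linear_bound (S \o Q \o P).
exists (c' * t * ((K1 + K2) * B) + (K3 + K4) * B + c * ((K3 + K4) * norm1 (P X))).
  by rewrite !addr_ge0 ?mulr_ge0 ?addr_ge0 ?norm1_ge0 // ltW.
move=> g g1; have g0 : 0 < g by exact: lt_le_trans g1.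
have gi0 : 0 <= g^-1 by rewrite invr_ge0 ltW.
have gi1 : g^-1 ^+ 2 <= g^-1.
  by rewrite expr2 ler_piMr // invf_le1.
have two (a b : V) (ka kb n : R) : 0 <= n -> 0 <= kb -> norm1 a <= ka * n ->
    norm1 b <= kb * n -> norm1 (g^-1%:C *: a + (g^-1 ^+ 2)%:C *: b) <= g^-1 * ((ka + kb) * n).
  move=> n0 kb0 ha hb; rewrite (le_trans (norm1D _ _)) // !norm1Zr mulrDl mulrDr.
  rewrite !ger0_norm ?sqr_ge0 // lerD ?ler_wpM2l //.
  by rewrite ler_pM ?sqr_ge0 ?norm1_ge0.
have [A AE] := quadratic_family_linear g.
have dA : dissipative A.
  by move/funext: (AE) => ->; exact: quadratic_family_dissipative.
have [M ME] : exists M : {linear V -> V}, forall X,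
    M X = P X - g^-1%:C *: S (L1 (P X)) - (g^-1 ^+ 2)%:C *: S (Q (P X)).
  by exists (P \- g^-1%:C \*: (S \o L1 \o P) \- (g^-1 ^+ 2)%:C \*: (S \o Q \o P)).
rewrite -(opexpt_ext t AE).
have hMP Y : norm1 (P Y - M Y) <= g^-1 * ((K3 + K4) * norm1 Y).
  have -> : P Y - M Y = g^-1%:C *: S (L1 (P Y)) + (g^-1 ^+ 2)%:C *: S (Q (P Y)).
    by rewrite ME -addrA -opprD opprB addrC subrK.
  by apply: two; rewrite ?norm1_ge0 ?(ltW K40) ?hK3 ?hK4.
have hE s : 0 <= s <= t -> norm1 (opexpt s G (P X)) <= B by exact: hCE.
have hres s : 0 <= s <= t ->
    norm1 (M (G (opexpt s G (P X))) - A (M (opexpt s G (P X)))) <= g^-1 * ((K1 + K2) * B).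
  move=> /hE hs; rewrite (corrector_residual _ g0 AE GE ME).
  have := two _ _ K1 K2 _ (norm1_ge0 _) (ltW K20)
    (hK1 (opexpt s G (P X))) (hK2 (opexpt s G (P X))).
  move=> /le_trans; apply; rewrite ler_wpM2l // ler_wpM2l // addr_ge0 // ltW //.
have tt : 0 <= t <= t by rewrite t0 lexx.
have h1 := hc' A G M (P X) t _ dA t0 hres.
have h2 := hMP (opexpt t G (P X)).
have h3 := hc A t _ dA t0 : norm1 (opexpt t A (P X - M (P X))) <= _.
have h4 := hMP (P X); rewrite PP in h4.
have e3 : opexpt t A (P X - M (P X)) = opexpt t A (P X) - opexpt t A (M (P X)).
  exact: linearB.
rewrite e3 in h3.
rewrite (telescope3 _ (opexpt t A (M (P X))) (M (opexpt t G (P X)))).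
have hEt := hE t tt.
rewrite (le_trans (norm1B _ _)) //.
apply: (le_trans (lerD (le_trans (norm1B _ _) (lerD (le_trans h3 (ler_wpM2l (ltW c0) h4)) h1)) h2)).
have h5 : g^-1 * ((K3 + K4) * norm1 (opexpt t G (P X))) <= g^-1 * ((K3 + K4) * B).
  by rewrite ler_wpM2l // ler_wpM2l // addr_ge0 // ltW.
apply: (le_trans (lerD (lexx _) h5)).
by rewrite le_eqVlt; apply/orP; left; apply/eqP; ring.
Qed.

(** Slowed down by the factor [g ^- 2] the family is close to [L2], so within a time
of that order it damps [X - P X]; afterwards the uniform bound keeps it small. *)
Lemma fast_modes_vanish (t : R) X : 0 < t -> forall eta : R, 0 < eta ->
  \forall g \near +oo,
    norm1 (opexpt t (quadratic_family L0 L1 L2 g) (X - P X)) <= eta.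
Proof.
move=> t0 eta eta0; set W := X - P X.
have [c c0 hc] := @opexpt_uniform_bound R d.
have [c' c'0 hc'] := @opexpt_intertwining_error R d.
have e2 : 0 < eta / 2 / c by rewrite !divr_gt0.
have [tau tau0 htau] : exists2 tau, 0 < tau & norm1 (opexpt tau L2 W) <= eta / 2 / c.
  have PW : P W = 0 by rewrite /W (linearB P) PP subrr.
  have := @P_cvg W; rewrite PW => /cvg_norm1P/cvgr0Pnorm_le/(_ _ e2) hW.
  near (+oo : set_system R) => s; exists s; first by near: s; exact: nbhs_pinfty_gt.
  rewrite -[norm1 _]ger0_norm ?norm1_ge0 // -[opexpt s L2 W]subr0.
  by near: s.
have [CE CE0 hCE] := opexpt_bound L2 (ltW tau0).
have [K0 K00 hK0] := norm1_linear_bound L0.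
have [K1 K10 hK1] := norm1_linear_bound L1.
pose B := CE * norm1 W.
have B0 : 0 <= B by rewrite mulr_ge0 ?norm1_ge0 // ltW.
pose D := c' * tau * ((K0 + K1) * B).
have D0 : 0 <= D.
  apply: mulr_ge0; first exact: mulr_ge0 (ltW c'0) (ltW tau0).
  by apply: mulr_ge0 B0; exact: addr_ge0 (ltW K00) (ltW K10).
near=> g.
have g1 : 1 <= g by near: g; apply: nbhs_pinfty_ge; exact: num_real.
have gt : tau / t <= g by near: g; apply: nbhs_pinfty_ge; exact: num_real.
have gD : D / (eta / 2 / c) <= g by near: g; apply: nbhs_pinfty_ge; exact: num_real.
have g0 : 0 < g by exact: lt_le_trans g1.
have gi0 : 0 < g^-1 by rewrite invr_gt0.
have gi1 : g^-1 ^+ 2 <= g^-1.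
  by rewrite expr2 ler_piMr ?(ltW gi0) // invf_le1.
have [A AE] := quadratic_family_linear g.
have dA : dissipative A.
  by move/funext: (AE) => ->; exact: quadratic_family_dissipative.
have [A' A'E] : exists A' : {linear V -> V}, forall Y, A' Y = (g^-1 ^+ 2)%:C *: A Y.
  by exists ((g^-1 ^+ 2)%:C \*: A).
have dA' : dissipative A'.
  move/funext: (A'E) => ->; apply: dissipativeZ => //; exact: exprn_gt0.
have A'E2 Y : A' Y = (g^-1 ^+ 2)%:C *: L0 Y + g^-1%:C *: L1 Y + L2 Y.
  have gn0 : g%:C != 0 :> C.
    by rewrite -(rmorph0 (real_complex R)) (inj_eq (@complexI R)) gt_eqF.
  rewrite A'E AE /quadratic_family !rmorphXn !fmorphV /=.
  move: (g%:C) gn0 => z z0; move: (L0 Y) (L1 Y) (L2 Y) => x y w.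
  by apply/matrixP => i j; rewrite !mxE; field.
rewrite -(opexpt_ext t AE).
have hres s : 0 <= s <= tau ->
    norm1 (L2 (opexpt s L2 W) - A' (opexpt s L2 W)) <= g^-1 * ((K0 + K1) * B).
  move=> hs; have hU := hCE _ W hs; rewrite A'E2.
  move: (opexpt s L2 W) hU => U hU.
  have -> : L2 U - ((g^-1 ^+ 2)%:C *: L0 U + g^-1%:C *: L1 U + L2 U) =
      - ((g^-1 ^+ 2)%:C *: L0 U + g^-1%:C *: L1 U).
    by move: (L0 U) (L1 U) (L2 U) => x y w; apply/matrixP => i j; rewrite !mxE; ring.
  rewrite norm1N (le_trans (norm1D _ _)) // !norm1Zr !ger0_norm ?sqr_ge0 ?(ltW gi0) //.
  rewrite mulrDl mulrDr lerD //.
    rewrite ler_pM ?sqr_ge0 ?norm1_ge0 // (le_trans (hK0 _)) //.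
    by rewrite ler_wpM2l // ltW.
  by rewrite ler_wpM2l ?(ltW gi0) // (le_trans (hK1 _)) // ler_wpM2l // ltW.
have h1 := hc' A' L2 idfun W tau _ dA' (ltW tau0) hres.
have tauE : opexpt tau A' W = opexpt (tau * g^-1 ^+ 2) A W.
  by rewrite (opexpt_ext tau A'E) opexpt_scaleE.
have small : tau * g^-1 ^+ 2 <= t.
  apply: le_trans (ler_wpM2l (ltW tau0) gi1) _.
  by rewrite (ler_pdivrMr _ _ g0) mulrC -(ler_pdivrMr _ _ t0).
move: (tau * g^-1 ^+ 2) tauE small => r tauE rt.
have tr0 : 0 <= t - r by rewrite subr_ge0.
have -> : opexpt t A W = opexpt (t - r) A (opexpt tau A' W).
  rewrite tauE; have tE : t = t - r + r by rewrite subrK.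
  rewrite {1}tE; exact: (opexptD A r W tr0).
apply: (le_trans (hc A (t - r) _ dA tr0)).
rewrite mulrC -(ler_pdivlMr _ _ c0).
have -> : eta / c = eta / 2 / c + eta / 2 / c by field; rewrite gt_eqF.
apply: (le_trans (norm1_triangle (opexpt tau L2 W) _)); apply: lerD htau.
apply: (le_trans h1).
have -> : c' * tau * (g^-1 * ((K0 + K1) * B)) = D / g by rewrite /D; ring.
by rewrite (ler_pdivrMr _ _ g0) mulrC -(ler_pdivrMr _ _ e2).
Unshelve. all: by end_near. Qed.

Lemma strong_damping_limit (G : {linear V -> V}) (t : R) X : 0 < t ->
  (forall X, G X = P (Q (P X))) ->
  opexpt t (quadratic_family L0 L1 L2 g) X @[g --> +oo] --> P (opexpt t G (P X)).
Proof.
move=> t0 GE; apply/cvg_norm1P/cvgr0Pnorm_le => eta eta0.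
have [D D0 hD] := slow_modes_limit X (ltW t0) GE.
have e2 : 0 < eta / 2 by rewrite divr_gt0.
have hfast := fast_modes_vanish X t0 e2.
near=> g.
have g1 : 1 <= g by near: g; apply: nbhs_pinfty_ge; exact: num_real.
have gD : D / (eta / 2) <= g by near: g; apply: nbhs_pinfty_ge; exact: num_real.
have g0 : 0 < g by exact: lt_le_trans g1.
rewrite ger0_norm ?norm1_ge0 //.
have [A AE] := quadratic_family_linear g.
rewrite (split_proj _ (opexpt t (quadratic_family L0 L1 L2 g) (P X))).
have e T : opexpt t A = T -> T X - T (P X) = T (X - P X).
  by move=> <-; apply/esym; exact: linearB.
rewrite [eta]splitr; apply: le_trans (norm1D _ _) _; apply: lerD.
  by rewrite (le_trans (hD g g1)) // (ler_pdivrMr _ _ g0) mulrC -(ler_pdivrMr _ _ e2).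
by rewrite (e _ (opexpt_ext t AE)); near: g.
Unshelve. all: by end_near. Qed.

End strong_damping.

Lemma leigenvalueP (R : realType) (d : nat) (A : {linear 'M[R[i]]_d -> 'M[R[i]]_d})
    (z : R[i]) X :
  X != 0 -> A X = z *: X -> passmx.leigenvalue (linfun A) z.
Proof.
move=> X0 AX; apply: contra_neq X0 => ker0; apply/eqP.
rewrite -memv0 -ker0 memv_ker add_lfunE opp_lfunE scale_lfunE id_lfunE lfunE /= AX.
by rewrite subrr.
Qed.

Unset Implicit Arguments.
Set Strict Implicit.

Theorem corollary3p4 (R : realType) (d : nat)
    (L0 L1 L2 : {linear 'M[R[i]]_d -> 'M[R[i]]_d})
    (hL0 : lindbladian L0) (hL1 : lindbladian L1) (hL2 : lindbladian L2)
    (hspec : forall z : R[i],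
       passmx.leigenvalue (linfun L2) z -> complex.Re z = 0 -> z = 0) :
  let P := asymptotic_proj L2 in
  let Linf := fun X : 'M[R[i]]_d =>
    P (L0 (P X)) - P (L1 (pseudo_inverse L2 (L1 (P X)))) in
  [/\ forall X, opexpt t L2 X @[t --> +oo] --> P X,
      forall X, P (P X) = P X
    & (forall X, P (L1 (P X)) = 0) ->
      forall t : R, 0 < t -> forall X,
        opexpt t (quadratic_family L0 L1 L2 gamma) X
          @[gamma --> +oo] --> P (opexpt t Linf (P X))].
Proof.
move=> P Linf.
have dL2 := lindbladian_dissipative hL2.
have eig z X : X != 0 -> L2 X = z *: X -> complex.Re z = 0 -> z = 0.
  by move=> X0 LX; apply: hspec; exact: leigenvalueP X0 LX.
split; [exact: asymptotic_proj_cvg|exact: asymptotic_proj_idem|].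
move=> PL1P t t0 X.
have [Pl PE] := linear_lift (asymptotic_proj_is_linear dL2 eig).
have [Sl SE] := linear_lift (pseudo_inverse_is_linear dL2 eig).
have [G GE] : exists G : {linear 'M[R[i]]_d -> 'M[R[i]]_d}, forall X,
    G X = Pl ((L0 \- (L1 \o Sl \o L1)) (Pl X)).
  by exists (Pl \o (L0 \- (L1 \o Sl \o L1)) \o Pl).
have LG : Linf =1 G.
  by move=> Y; rewrite GE /= (linearB Pl) !PE !SE.
have PlE Y : P Y = Pl Y by rewrite PE.
rewrite (opexpt_ext t LG) !PlE.
have dL0 := lindbladian_dissipative hL0.
have dL1 := lindbladian_dissipative hL1.
have PP Y : Pl (Pl Y) = Pl Y by rewrite !PE; exact: asymptotic_proj_idem.
have L2P Y : L2 (Pl Y) = 0 by rewrite PE; exact: gen_asymptotic_proj.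
have L2S Y : L2 (Sl Y) = Y - Pl Y by rewrite PE SE; exact: gen_pseudo_inverse.
have Pcvg Y : opexpt s L2 Y @[s --> +oo] --> Pl Y.
  by rewrite PE; exact: asymptotic_proj_cvg.
have PlL1 Y : Pl (L1 (Pl Y)) = 0 by rewrite !PE; exact: PL1P.
have H := strong_damping_limit dL0 dL1 dL2 PP L2P L2S Pcvg PlL1.
exact (H G t X t0 GE).
Qed.
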